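(* Let $\{Y_t,\ t\in\mathbb{Z}\}$ be a stationary and ergodic $\mathbb{N}_0^m$-valued process satisfying $\mathbb{E}(Y_t\mid\mathcal F_{t-1})=f_{\theta^*}(Y_{t-1},Y_{t-2},\dots)$ for all $t\in\mathbb{Z}$, with $\theta^*\in\Theta$. Assume: (1) (Assumption $\mathbf A_0(\Theta)$ with decay) for any $y\in(\mathbb{N}_0^m)^\infty$, $\theta\mapsto f_\theta(y)$ is continuous on $\Theta$, $\|f_\theta(0)\|_\Theta<\infty$, and there are non-negative reals $(\alpha_k^{(0)})_{k\ge1}$ with $\sum_{k\ge1}\alpha_k^{(0)}<1$ such that $\|f_\theta(y)-f_\theta(y')\|_\Theta\le\sum_{k\ge1}\alpha_k^{(0)}\|y_k-y'_k\|$ for all $y,y'\in(\mathbb{N}_0^m)^\infty$; moreover $\alpha_k^{(0)}=\mathcal O(k^{-\gamma})$ for some $\gamma>3/2$; (2) for all $\theta\in\Theta$: if $f_{\theta^*}(Y_{t-1},Y_{t-2},\dots)=f_\theta(Y_{t-1},Y_{t-2},\dots)$ a.s. for some $t\in\mathbb{Z}$, then $\theta^*=\theta$; moreover there exists $\underline c>0$ such that $f_\theta(y)\ge\underline c\,\mathbf 1_m$ componentwise for all $\theta\in\Theta$, $y\in(\mathbb{N}_0^m)^\infty$, where $\mathbf 1_m=(1,\dots,1)^T\in\mathbb{R}^m$; (3) there exist $C>0$ and $\epsilon\ge1$ such that $\|Y_t\|_{1+\epsilon}<C$ for all $t\in\mathbb{Z}$. Then the Poisson quasi-maximum likelihood estimator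 $\widehat\theta_n$ computed from $Y_1,\dots,Y_n$ (defined in the context) satisfies $$\widehat\theta_n\longrightarrow\theta^*\quad\text{almost surely as }n\to\infty.$$
   Context: $\mathbb{N}_0=\mathbb{N}\cup\{0\}$, $\Theta\subset\mathbb{R}^d$ is compact, $\mathcal F_{t-1}=\sigma(Y_{t-1},Y_{t-2},\dots)$, and $f_\theta:(\mathbb{N}_0^m)^\infty\to\mathbb{R}^m$ is measurable with non-negative components. Norms: $\|x\|=\sum_i|x_i|$ for vectors; $\|g\|_\Theta=\sup_{\theta\in\Theta}\|g(\theta)\|$; $\|Y\|_r=(\mathbb{E}\|Y\|^r)^{1/r}$ for a random vector $Y$. Poisson QMLE. Put $\widehat\lambda_t(\theta)=(\widehat\lambda_{t,1}(\theta),\dots,\widehat\lambda_{t,m}(\theta))^T=f_\theta(Y_{t-1},\dots,Y_1,0,0,\dots)$, $$\widehat\ell_t(\theta)=\sum_{i=1}^m\big(Y_{t,i}\log\widehat\lambda_{t,i}(\theta)-\widehat\lambda_{t,i}(\theta)\big),\qquad \widehat L_n(\theta)=\sum_{t=1}^n\widehat\ell_t(\theta),\qquad \widehat\theta_n=\operatorname{argmax}_{\theta\in\Theta}\widehat L_n(\theta),$$ where $Y_{t,i}$ is the $i$-th component of $Y_t$. *)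

(* Defs.v *)
From HB Require Import structures.
From mathcomp Require Export all_boot all_order all_algebra.
From mathcomp Require Export all_classical all_reals all_analysis.

Set Implicit Arguments.
Unset Strict Implicit.
Unset Printing Implicit Defensive.

Export Order.TTheory GRing.Theory Num.Theory.
Export numFieldNormedType.Exports.

Local Open Scope classical_set_scope.
Local Open Scope ring_scope.

(* The sigma-algebra sigma(X_i, i \in D); with D = setT and X_i the i-th
   coordinate map it is the product sigma-algebra. *)
Definition sigma_gen {d : measure_display} {E : measurableType d} {T I : Type}
    (D : set I) (X : I -> T -> E) : set (set T) :=
  <<s \bigcup_(i in D) preimage_set_system setT (X i) measurable >>.

Definition product_sigma {d : measure_display} (E : measurableType d)
    (I : Type) : set (set (I -> E)) :=
  sigma_gen setT (fun (i : I) (y : I -> E) => y i).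
Arguments product_sigma {d} E I _.

Definition measurable_wrt {d : measure_display} {E : measurableType d}
    {T : Type} (G : set (set T)) (Z : T -> E) : Prop :=
  forall B : set E, measurable B -> G (Z @^-1` B).

Section processes.
Context {dO : measure_display} {Omega : measurableType dO} {R : realType}.
Variable P : probability Omega R.

(* Z is a version of E(X | G). *)
Definition is_cond_exp (G : set (set Omega)) (X Z : Omega -> R) : Prop :=
  [/\ P.-integrable setT (EFin \o X),
      P.-integrable setT (EFin \o Z),
      measurable_wrt G Z
    & forall A : set Omega, G A ->
        (\int[P]_(w in A) (Z w)%:E = \int[P]_(w in A) (X w)%:E)%E].

Context {dE : measure_display} {E : measurableType dE}.
Implicit Type Y : int -> Omega -> E.

Definition shift (y : int -> E) : int -> E := fun t => y (t + 1).

Definition trajectory Y (w : Omega) : int -> E := fun t => Y t w.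

Definition strictly_stationary Y : Prop :=
  forall A : set (int -> E), product_sigma E int A ->
    P (trajectory Y @^-1` (shift @^-1` A)) = P (trajectory Y @^-1` A).

Definition ergodic Y : Prop :=
  forall A : set (int -> E), product_sigma E int A -> shift @^-1` A = A ->
    (P (trajectory Y @^-1` A) = 0 \/ P (trajectory Y @^-1` A) = 1)%E.

(* F_(t-1) = sigma(Y_(t-1), Y_(t-2), ...) *)
Definition past_sigma Y (t : int) : set (set Omega) :=
  sigma_gen [set s : int | s < t] Y.

End processes.

(* A sequence (y_1, y_2, ...) is encoded by a function y : nat -> E whose value
   at k is y_(k+1); this one is (y_(t-1), y_(t-2), ...). *)
Definition past_seq {E : Type} (y : int -> E) (t : int) : nat -> E :=
  fun k => y (t - k.+1%:Z).

Section counts.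
Context {R : realType} {m : nat}.

Definition count0 : m.-tuple nat := [tuple 0%N | i < m].

Definition vec_of_count (x : m.-tuple nat) : 'rV[R]_m :=
  \row_i (tnth x i)%:R.

(* The library's norm on matrices is the sup norm. *)
Definition norm1 (x : 'rV[R]_m) : R := \sum_(i < m) `|x 0 i|.

Definition sup_norm {S : Type} (Theta : set S) (g : S -> 'rV[R]_m) : \bar R :=
  ereal_sup [set (norm1 (g theta))%:E | theta in Theta].

Section qmle.
Context {S : Type}.
Variable f : S -> (nat -> m.-tuple nat) -> 'rV[R]_m.

(* (y_(t-1), ..., y_1, 0, 0, ...) *)
Definition truncated_past (y : int -> m.-tuple nat) (t : nat) :
    nat -> m.-tuple nat :=
  fun k => if (k.+1 < t)%N then past_seq y t%:Z k else count0.

Definition lambda_hat (y : int -> m.-tuple nat) (t : nat) (theta : S) :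
    'rV[R]_m := f theta (truncated_past y t).

Definition ell_hat (y : int -> m.-tuple nat) (t : nat) (theta : S) : R :=
  \sum_(i < m) ((tnth (y t%:Z) i)%:R * ln (lambda_hat y t theta 0 i)
                - lambda_hat y t theta 0 i).

Definition L_hat (y : int -> m.-tuple nat) (n : nat) (theta : S) : R :=
  \sum_(1 <= t < n.+1) ell_hat y t theta.

(* The maximizer need not be unique: any choice qualifies. *)
Definition is_qmle (Theta : set S) (y : int -> m.-tuple nat) (n : nat)
    (theta_hat : S) : Prop :=
  Theta theta_hat /\
  forall theta, Theta theta -> L_hat y n theta <= L_hat y n theta_hat.

End qmle.
End counts.

(* Main.v *)
From HB Require Import structures.
Require Import Defs.
From mathcomp Require Import measurable_realfun ring lra zify.

Set Implicit Arguments.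
Unset Strict Implicit.
Unset Printing Implicit Defensive.

Local Open Scope classical_set_scope.
Local Open Scope ring_scope.

(** Wald's argument, with a one-sided ergodic theorem in place of Birkhoff's.
    If [g] is integrable with negative mean, the ergodic sums of [g] tend to
    [-oo] almost surely. For [theta0 <> theta_star], the Poisson log-likelihood
    contrast between [f theta0] and [f theta_star] along the infinite past has
    negative mean: conditioning on the past turns it into minus a sum of
    Poisson Kullback-Leibler divergences.

    To pass to the truncated past and to all [theta] near [theta0] at once,
    every past is compared with its truncation to [K] coordinates capped at [K].
    These truncations take finitely many values, so continuity of the [f theta]
    at these values gives a neighbourhood of [theta0] on which the [f theta] are
    uniformly close there, and the Lipschitz condition bounds all remaining
    errors by a stationary penalty whose mean tends to [0] as [K] tends to
    infinity. For [K] large the penalized contrast still has negative mean, so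
    almost surely no [theta] of the neighbourhood beats [theta_star] eventually;
    compactness of [Theta] concludes. *)

(** * A one-sided ergodic theorem *)

Section ergodic_drift.
Context {d : measure_display} {T : measurableType d} {R : realType}.
Variables (Q : probability T R) (tau : T -> T).
Hypothesis mtau : measurable_fun setT tau.
Hypothesis tauQ : forall A, measurable A -> Q (tau @^-1` A) = Q A.

Lemma ge0_integral_preserving (f : T -> \bar R) :
  measurable_fun setT f -> (forall x, 0 <= f x)%E ->
  (\int[Q]_x f (tau x) = \int[Q]_x f x)%E.
Proof.
move=> mf f0.
have := @ge0_integral_pushforward _ _ _ _ R _ mtau Q setT f measurableT mf
  (fun x _ => f0 x).
rewrite preimage_setT => <-.
by apply: eq_measure_integral => A mA _; exact: tauQ.
Qed.

Lemma measurable_iter_preserving k : measurable_fun setT (iter k tau).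
Proof.
elim: k => [|k IH]; first exact: measurable_id.
exact: (measurableT_comp mtau IH).
Qed.

Section running_max.
Variable h : T -> R.
Hypothesis ih : Q.-integrable setT (EFin \o h).

(** The maximum over [0 <= j <= n] of the ergodic sums of [h] of length [j], obtained by splitting
    off the first term. *)
Fixpoint running_max n x : R :=
  if n is n'.+1 then Num.max 0 (h x + running_max n' (tau x)) else 0.

Lemma running_max_ge0 n x : 0 <= running_max n x.
Proof. by case: n => [//|n] /=; rewrite le_max lexx. Qed.

Lemma running_max_nondecreasing n x : running_max n x <= running_max n.+1 x.
Proof.
elim: n x => [|n IH] x; first exact: running_max_ge0.
by rewrite /= ge_max !le_max lexx /= lerD2l IH orbT.
Qed.

Lemma sum_le_running_max n x :
  \sum_(k < n) h (iter k tau x) <= running_max n x.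
Proof.
elim: n x => [|n IH] x; first by rewrite big_ord0.
rewrite big_ord_recl le_max; apply/orP; right; rewrite lerD2l.
apply: le_trans (IH _); rewrite le_eqVlt; apply/orP; left; apply/eqP.
by apply: eq_bigr => i _; rewrite lift0 iterSr.
Qed.

Lemma measurable_running_max n : measurable_fun setT (running_max n).
Proof.
elim: n => [|n IH] /=; first exact: measurable_cst.
apply: measurable_maxr; first exact: measurable_cst.
apply: measurable_funD; last exact: (measurableT_comp IH mtau).
by apply/measurable_EFinP; case/integrableP: ih.
Qed.

Lemma integrable_running_max_tau n :
  Q.-integrable setT (EFin \o running_max n) ->
  Q.-integrable setT (fun x => (running_max n (tau x))%:E).
Proof.
move=> /integrableP[_ iM]; apply/integrableP; split.
  by apply/measurable_EFinP; exact: (measurableT_comp (measurable_running_max n) mtau).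
apply: le_lt_trans iM.
rewrite (ge0_integral_preserving (f := fun x => `|(running_max n x)%:E|%E)) //.
by apply: measurableT_comp => //; apply/measurable_EFinP; exact: measurable_running_max.
Qed.

Lemma integrable_running_max n : Q.-integrable setT (EFin \o running_max n).
Proof.
elim: n => [|n IH] /=; first exact: integrable0.
have iD : Q.-integrable setT ((EFin \o h) \+ (fun x => (running_max n (tau x))%:E))%E.
  by apply: integrableD => //; exact: integrable_running_max_tau.
apply: le_integrable iD => //.
  by apply/measurable_EFinP; exact: (measurable_running_max n.+1).
move=> x _ /=; rewrite lee_fin ger0_norm ?le_max ?lexx//.
by rewrite ge_max normr_ge0 ler_norm.
Qed.

(* With M_n the running maximum, M_(n+1) - M_n o tau = max(-M_n o tau, h) has
   non-negative integral and tends to h wherever M_n o tau tends to +oo. *)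
Lemma integral_ge0_of_unbounded_sums :
  {ae Q, forall x, forall B : R, exists n, B < \sum_(k < n) h (iter k tau (tau x))} ->
  (0 <= \int[Q]_x (h x)%:E)%E.
Proof.
move=> hub.
pose D n x := running_max n.+1 x - running_max n (tau x).
have DE n x : D n x = Num.max (- running_max n (tau x)) (h x).
  by rewrite /D /= addr_maxl add0r addrK.
have mh : measurable_fun setT h.
  by apply/measurable_EFinP; case/integrableP: ih.
have mM n : measurable_fun setT (fun x => running_max n (tau x)).
  exact: (measurableT_comp (measurable_running_max n) mtau).
have [|||||_ _ cvgD] := @dominated_convergence _ T R Q setT measurableT
    (fun n x => (D n x)%:E) (EFin \o h) (fun x => `|(h x)%:E|)%E.
- move=> n; apply/measurable_EFinP; apply: measurable_funB => //.
  exact: measurable_running_max.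
- exact/measurable_EFinP.
- apply: filterS hub => x hx _ /=.
  (* Once the maximum at [tau x] exceeds [- h x], [D n x] equals [h x]: the convergence is
     stationary. *)
  have [N hN] := hx (- h x).
  apply: cvg_near_cst; exists N => // n /= Nn.
  congr EFin; rewrite DE; apply/max_idPr.
  rewrite lerNl; apply: (le_trans (ltW hN)).
  apply: (le_trans (sum_le_running_max _ _)).
  have /nondecreasing_seqP : forall n,
      running_max n (tau x) <= running_max n.+1 (tau x).
    by move=> k; exact: running_max_nondecreasing.
  by apply; exact: Nn.
- by apply: integrable_abse.
- apply: aeW => x n _.
  rewrite !abse_EFin lee_fin DE.
    have M0 := running_max_ge0 n (tau x).
  rewrite /Num.max; case: ifPn => //; rewrite -leNgt => hM.
  have hx0 : h x <= 0 by apply: le_trans hM _; rewrite oppr_le0.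
  by rewrite (ler0_norm hx0) normrN (ger0_norm M0) lerNr.
(* By invariance of [Q], the integral of [D n] is that of [running_max n.+1] minus that of
   [running_max n]. *)
rewrite -(cvg_lim _ cvgD)//; apply: lime_ge; first by apply/cvg_ex; eexists; exact: cvgD.
apply: nearW => n /=.
under eq_integral do rewrite EFinB.
rewrite integralB_EFin//; last 2 first.
- exact: integrable_running_max.
- by apply: integrable_running_max_tau; exact: integrable_running_max.
rewrite (ge0_integral_preserving (f := EFin \o running_max n)); last 2 first.
- by apply/measurable_EFinP; exact: measurable_running_max.
- by move=> x; rewrite lee_fin running_max_ge0.
have fM : (\int[Q]_x (running_max n x)%:E)%E \is a fin_num.
  by apply: integrable_fin_num => //; exact: integrable_running_max.
rewrite suber_ge0//.
apply: le_integral => //; try exact: integrable_running_max.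
by move=> x _; rewrite lee_fin running_max_nondecreasing.
Qed.

End running_max.

(** Let [r] be the mean of [g] and [e = - r / 2], so that [h = g + e] still has negative mean. The
    set [A] where the sums of [h] are unbounded above is invariant, and it cannot have measure 1,
    since [h] would then have non-negative mean. Off [A] the sums of [h] are bounded by some [B],
    hence those of [g] by [B - n * e]. *)
Lemma ergodic_drift (g : T -> R) :
  (forall A, measurable A -> tau @^-1` A = A -> Q A = 0%E \/ Q A = 1%E) ->
  Q.-integrable setT (EFin \o g) -> (\int[Q]_x (g x)%:E < 0)%E ->
  {ae Q, forall x, (\sum_(k < n) g (iter k tau x)) @[n --> \oo] --> -oo}.
Proof.
move=> ergQ ig g0.
have /fineK gE := integrable_fin_num measurableT ig.
set r := fine _ in gE; rewrite -gE in g0.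
have r0 : r < 0 by rewrite -lte_fin.
pose e := - r / 2.
have e0 : 0 < e by rewrite divr_gt0 // oppr_gt0.
pose h x := g x + e.
have ie : Q.-integrable setT (EFin \o cst e).
  exact: (finite_measure_integrable_cst Q e).
have ih : Q.-integrable setT (EFin \o h).
  exact: (integrableD measurableT ig ie).
have mh : measurable_fun setT h.
  by apply/measurable_EFinP; case/integrableP: ih.
pose S n x := \sum_(k < n) h (iter k tau x).
have SS n x : S n.+1 x = h x + S n (tau x).
  rewrite /S big_ord_recl; congr (_ + _).
  by apply: eq_bigr => i _; rewrite lift0 iterSr.
have mS n : measurable_fun setT (S n).
  apply: measurable_sum => k.
  exact: (measurableT_comp mh (measurable_iter_preserving k)).
pose A := \bigcap_j \bigcup_n [set x | j%:R < S n x].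
have AP x : A x <-> forall B : R, exists n, B < S n x.
  split=> [Ax B|Ax j _]; last by have [n hn] := Ax j%:R; exists n.
  have [n _ hn] := Ax (Num.truncn B).+1 I; exists n; apply: le_lt_trans hn.
  exact/ltW/truncnS_gt.
have mA : measurable A.
  apply: bigcap_measurable => // j _; apply: bigcup_measurable => n _.
  rewrite -[X in measurable X]setTI.
  by rewrite (_ : [set x | _] = S n @^-1` `]j%:R, +oo[%classic);
    [exact: mS|apply/seteqP; split => x /=; rewrite in_itv /= andbT].
have tauA : tau @^-1` A = A.
  apply/seteqP; split => x /= /AP Ax; apply/AP => B.
    by have [n hn] := Ax (B - h x); exists n.+1; rewrite SS -ltrBlDl.
  (* The maximum with 0 rules out the empty sum, so [n] is a successor and the term [h x] can be
     split off. *)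
  have [n hn] := Ax (Num.max 0 (B + h x)).
  case: n hn => [|n]; first by rewrite /S big_ord0 gt_max ltxx.
  by rewrite SS gt_max [h x + _]addrC ltrD2r => /andP[_]; exists n.
have QA0 : Q A = 0%E.
  have [//|A1] := ergQ A mA tauA.
  have : (0 <= \int[Q]_x (h x)%:E)%E.
    apply: integral_ge0_of_unbounded_sums => //.
    exists (~` A); split; first exact: measurableC.
      by rewrite probability_setC// A1 subee.
    apply: subsetC => x; rewrite -{1}tauA => /AP; exact.
  have Ie : (\int[Q]_x e%:E = e%:E)%E.
    have := integral_cst Q measurableT e%:E.
    by rewrite [X in (_ * X)%E](_ : _ = 1%E) ?mule1//; exact: probability_setT.
  have -> : (\int[Q]_x (h x)%:E = (r + e)%:E)%E.
    by rewrite [RHS]EFinD -Ie gE; exact: (integralD measurableT ig ie).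
  by rewrite lee_fin leNgt /e {1}(splitr r) mulNr addrK pmulr_llt0 ?r0.
exists A; split => //; apply: subsetCl => x /= Ax.
have [B hB] : exists B : R, forall n, S n x <= B.
  apply: contrapT => nB; apply: Ax; apply/AP => B; apply: contrapT => nS.
  apply: nB; exists B => n; rewrite leNgt; apply/negP => nSn.
  by apply: nS; exists n.
apply/cvgrNyPle => a; near=> n.
have -> : \sum_(k < n) g (iter k tau x) = S n x - n%:R * e.
  by rewrite /S big_split /= sumr_const card_ord mulr_natl addrK.
rewrite lerBlDr -lerBlDl (le_trans (y := B - a)) ?lerB// -ler_pdivrMr//.
near: n; exact: nbhs_infty_ger.
Unshelve. all: by end_near. Qed.

End ergodic_drift.

(** The sets whose preimage lies in [G] form a sigma-algebra, which contains the generators. *)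
Lemma sigma_gen_preimage {d : measure_display} {E : measurableType d}
    {T T' I : Type} (D : set I) (X : I -> T' -> E) (G : set (set T))
    (phi : T -> T') :
  sigma_algebra setT G ->
  (forall i, D i -> measurable_wrt G (fun w => X i (phi w))) ->
  forall A, sigma_gen D X A -> G (phi @^-1` A).
Proof.
move=> sG hX A sA.
suff : image_set_system setT phi G A by rewrite /image_set_system /= setTI.
apply: (sA); split; first exact: sigma_algebra_image.
move=> _ [i Di [B mB <-]]; rewrite /image_set_system /= !setTI.
exact: hX Di _ mB.
Qed.

Lemma measurable_wrtT {d d' : measure_display} {T : measurableType d}
    {T' : measurableType d'} (Z : T -> T') :
  measurable_wrt measurable Z <-> measurable_fun setT Z.
Proof.
split=> [mZ _ B mB|mZ B mB]; first by rewrite setTI; exact: mZ.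
by rewrite -[X in measurable X]setTI; exact: mZ.
Qed.

(** * Drift along a stationary ergodic process *)

Section process_drift.
Context {dO : measure_display} {Omega : measurableType dO} {R : realType}.
Variable P : probability Omega R.
Context {dE : measure_display} {E : measurableType dE}.
Variable Y : int -> Omega -> E.
Hypothesis mY : forall t, measurable_fun setT (Y t).

(** Equips paths with a measurable structure whose measurable sets are, by conversion, those of
    [product_sigma]. *)
Let path_space : measurableType _ := g_sigma_algebraType
  (\bigcup_(i in [set: int]) preimage_set_system setT
     (fun y : int -> E => y i) measurable).

Let traj : Omega -> path_space := trajectory Y.

Lemma measurable_trajectory A : product_sigma E int A ->
  measurable (trajectory Y @^-1` A).
Proof.
apply: (sigma_gen_preimage (sigma_algebra_measurable Omega)) => i _.
by apply/measurable_wrtT; exact: mY.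
Qed.

Let mtraj : measurable_fun setT traj.
Proof. by move=> _ A mA; rewrite setTI; exact: measurable_trajectory. Qed.

HB.instance Definition _ := isMeasurableFun.Build _ _ _ _ traj mtraj.

Let mshift : measurable_fun setT (@shift _ E : path_space -> path_space).
Proof.
move=> _ A mA; rewrite setTI.
apply: (sigma_gen_preimage (sigma_algebra_measurable path_space) _ mA) => i _.
move=> B mB; apply: sub_sigma_algebra; exists (i + 1) => //.
by exists B => //; rewrite setTI.
Qed.

Lemma iter_shift (y : int -> E) k t : iter k (@shift _ E) y t = y (t + k%:Z).
Proof.
elim: k y t => [|k IH] y t; first by rewrite addr0.
by rewrite iterSr IH /shift intS addrA addrAC.
Qed.

(** Stationarity and ergodicity of [Y] say that the shift preserves the law of the trajectory and is
    ergodic for it. The drift under this law is then pulled back to [Omega]. *)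
Lemma process_drift (g : (int -> E) -> R) :
  strictly_stationary P Y -> ergodic P Y ->
  measurable_wrt (product_sigma E int) g ->
  P.-integrable setT (fun w => (g (trajectory Y w))%:E) ->
  (\int[P]_w (g (trajectory Y w))%:E < 0)%E ->
  {ae P, forall w,
    \sum_(k < n) g (fun t => Y (t + k%:Z) w) @[n --> \oo] --> -oo}.
Proof.
move=> statY ergY mg ig g0.
have mgp : measurable_fun setT (g : path_space -> R) by exact/measurable_wrtT.
have [N [mN N0 sN]] : {ae (distribution P traj), forall y : path_space,
    \sum_(k < n) g (iter k (@shift _ E) y) @[n --> \oo] --> -oo}.
  apply: ergodic_drift => //.
  - apply: integrable_pushforward => //; exact/measurable_EFinP.
  - by rewrite integral_distribution//; exact/measurable_EFinP.
exists (traj @^-1` N); split => //.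
  by rewrite -[X in measurable X]setTI; exact: mtraj.
apply: subset_trans (preimage_subset sN) => w; apply: contra_not => /=.
have -> : (fun n => \sum_(k < n) g (iter k (@shift _ E) (trajectory Y w))) =
    (fun n => \sum_(k < n) g (fun t => Y (t + k%:Z) w)) => //.
apply/funext => n; apply: eq_bigr => k _; congr g.
by apply/funext => t; rewrite iter_shift.
Qed.

End process_drift.

(** * Integrals against a conditional expectation *)

Section cond_exp_mul.
Context {dO : measure_display} {Omega : measurableType dO} {R : realType}.
Variable P : probability Omega R.
Variable G : set (set Omega).
Hypothesis sG : sigma_algebra setT G.
Hypothesis GO : G `<=` measurable.

Import HBSimple HBNNSimple.

(** On this copy of [Omega], simple functions have their level sets in [G], where the conditional
    expectation can be tested. *)
Let OmegaG : measurableType _ := g_sigma_algebraType G.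

Let measG (A : set OmegaG) : measurable A = G A.
Proof. by rewrite (measurable_g_measurableTypeE sG). Qed.

Lemma sub_measurable_wrt {d : measure_display} {E : measurableType d}
  (h : Omega -> E) : measurable_wrt G h -> measurable_fun setT h.
Proof. by move=> hG; apply/measurable_wrtT => B mB; apply: GO; exact: hG. Qed.

Let integral_nnsfun_mul (phi : {nnsfun OmegaG >-> R}) (X : Omega -> R) :
  measurable_fun setT X -> (forall w, 0 <= X w) ->
  (\int[P]_w (phi w * X w)%:E = \sum_(a \in range phi)
     (a%:E * \int[P]_(w in phi @^-1` [set a]) (X w)%:E))%E.
Proof.
move=> mX X0.
have Gphi a : G (phi @^-1` [set a]) by rewrite -measG; exact: measurable_funPTI.
have mphi a : measurable (phi @^-1` [set a] : set Omega) by exact: GO.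
pose F a (w : Omega) : R := a * \1_(phi @^-1` [set a] : set Omega) w * X w.
have F0 a w : 0 <= F a w.
  rewrite /F mulr_ge0// indicE.
  by have [/set_mem <-|] := boolP (w \in _); rewrite ?mulr1 ?mulr0.
have mF a : measurable_fun setT (fun w => (F a w)%:E).
  apply/measurable_EFinP; apply: measurable_funM => //.
  apply: measurable_funM; first exact: measurable_cst.
  by apply: measurable_indic; exact: mphi.
have phiE w : (phi w * X w)%:E = (\sum_(a \in range phi) (F a w)%:E)%E.
  by rewrite fsumEFin// fimfunE mulr_fsuml.
transitivity (\int[P]_w (\sum_(a \in range phi) (F a w)%:E)%R)%E.
  by apply: eq_integral => w _; exact: phiE.
rewrite ge0_integral_fsum//; last by move=> a w _; rewrite lee_fin.
apply: eq_fsbigr => a /set_mem[w0 _ phia].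
rewrite [in RHS]integral_mkcond -ge0_integralZl_EFin//.
- apply: eq_integral => w _; rewrite epatch_indic/= -!EFinM /F.
  by rewrite mulrAC -mulrA.
- by move=> w _; rewrite epatch_indic/= -EFinM lee_fin mulr_ge0.
- apply/(measurable_restrictT _ (mphi a)).
  by apply: measurable_funTS; exact/measurable_EFinP.
- by rewrite -phia.
Qed.

(** For a simple function in place of [h], the defining property of [Z] applies on each level set;
    monotone convergence does the rest. Both sides may be infinite, so integrability can be
    transferred from one to the other. *)
Lemma ge0_integral_mul_cond_exp (X Z h : Omega -> R) :
  is_cond_exp P G X Z -> measurable_wrt G h ->
  (forall w, 0 <= X w) -> (forall w, 0 <= Z w) -> (forall w, 0 <= h w) ->
  (\int[P]_w (h w * Z w)%:E = \int[P]_w (h w * X w)%:E)%E.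
Proof.
move=> [/integrableP[/measurable_EFinP mX _] /integrableP[/measurable_EFinP mZ _]].
move=> _ ZX Gh X0 Z0 h0.
have mh : measurable_fun setT (EFin \o h : OmegaG -> \bar R).
  by apply/measurable_EFinP/measurable_wrtT => B mB; rewrite measG; exact: Gh.
pose phi := nnsfun_approx measurableT mh.
have mphi n : measurable_fun setT (phi n : Omega -> R).
  apply: sub_measurable_wrt => B mB; rewrite -measG; exact: measurable_funPTI.
have limphi (V : Omega -> R) : measurable_fun setT V -> (forall w, 0 <= V w) ->
    (\int[P]_w (h w * V w)%:E = limn (fun n => \int[P]_w (phi n w * V w)%:E))%E.
  move=> mV V0; rewrite -monotone_convergence//.
  - apply: eq_integral => w _; apply/esym/cvg_lim => //.
    have /fine_cvgP[_] := cvg_nnsfun_approx measurableT mh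
      (fun w _ => h0 w : (0 <= (h w)%:E)%E) (I : setT w).
    rewrite /= => hw; apply/cvg_EFin; first exact: nearW.
    by apply: cvgM; [exact: hw|exact: cvg_cst].
  - by move=> n; apply/measurable_EFinP; exact: measurable_funM.
  - by move=> n w _; rewrite lee_fin mulr_ge0.
  - move=> w _ n k nk; rewrite lee_fin ler_wpM2r//.
    by have /lefP := nd_nnsfun_approx measurableT mh nk; apply.
rewrite !limphi//; congr (limn _); apply/funext => n.
rewrite !integral_nnsfun_mul//; apply: eq_fsbigr => a _; congr (_ * _)%E.
by apply: ZX; rewrite -measG; exact: measurable_funPTI.
Qed.

(** As [X] and [Z] are non-negative, the positive and negative parts of the products come from those
    of [h] alone. *)
Lemma integral_mul_cond_exp (X Z h : Omega -> R) :
  is_cond_exp P G X Z -> measurable_wrt G h ->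
  (forall w, 0 <= X w) -> (forall w, 0 <= Z w) ->
  (\int[P]_w (h w * Z w)%:E = \int[P]_w (h w * X w)%:E)%E.
Proof.
move=> XZ Gh X0 Z0.
have mh : measurable_fun setT (h : OmegaG -> R).
  by apply/measurable_wrtT => B mB; rewrite measG; exact: Gh.
have hpos (V : Omega -> R) : (forall w, 0 <= V w) ->
    ((fun w => (h w * V w)%:E)^\+ = (fun w => (h^\+ w * V w)%:E))%E.
  move=> V0; apply/funext => w.
  by rewrite funeposE /funrpos -EFin_max maxr_pMl ?mul0r.
have hneg (V : Omega -> R) : (forall w, 0 <= V w) ->
    ((fun w => (h w * V w)%:E)^\- = (fun w => (h^\- w * V w)%:E))%E.
  move=> V0; apply/funext => w.
  by rewrite funenegE /funrneg -EFinN -EFin_max maxr_pMl ?mul0r ?mulNr.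
rewrite !(integralE _ _ (fun w => (h w * _ w)%:E)) !hpos// !hneg//.
rewrite -!(ge0_integral_mul_cond_exp XZ)//.
- move=> B mB; rewrite -measG -[X in measurable X]setTI.
  exact: (measurable_funrneg mh).
- move=> B mB; rewrite -measG -[X in measurable X]setTI.
  exact: (measurable_funrpos mh).
Qed.

End cond_exp_mul.

(** * Poisson log-likelihood and truncation of sequences of counts *)

Section poisson_loglik.
Context {R : realType} {m : nat}.
Implicit Types (y : m.-tuple nat) (l : 'rV[R]_m).

(** The log-density of independent Poisson variables with means [l], without the log-factorial
    terms, which are free of [l]. *)
Definition poisson_loglik y l : R :=
  \sum_(i < m) ((tnth y i)%:R * ln (l 0 i) - l 0 i).

Lemma norm1_vec_of_count y :
  norm1 (vec_of_count (R := R) y) = \sum_(i < m) (tnth y i)%:R.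
Proof. by apply: eq_bigr => i _; rewrite mxE normr_nat. Qed.

Lemma norm1_ge0 l : 0 <= norm1 l.
Proof. by apply: sumr_ge0 => i _; exact: normr_ge0. Qed.

Lemma ler_norm1D l l' : norm1 (l + l') <= norm1 l + norm1 l'.
Proof. by rewrite -big_split; apply: ler_sum => i _; rewrite mxE ler_normD. Qed.

Lemma norm10 : norm1 (0 : 'rV[R]_m) = 0.
Proof. by apply: big1 => i _; rewrite mxE normr0. Qed.

Lemma norm1_distC l l' : norm1 (l - l') = norm1 (l' - l).
Proof. by apply: eq_bigr => i _; rewrite !mxE distrC. Qed.

Lemma ler_norm1_dist l1 l2 l3 :
  norm1 (l1 - l3) <= norm1 (l1 - l2) + norm1 (l2 - l3).
Proof. by rewrite -[l1 - l3](subrKA l2) ler_norm1D. Qed.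

Lemma norm_coord_le_norm1 l i : `|l 0 i| <= norm1 l.
Proof.
by rewrite /norm1 (bigD1 i)//= lerDl sumr_ge0// => j _; exact: normr_ge0.
Qed.

Lemma count_le_norm1 y i : (tnth y i)%:R <= norm1 (vec_of_count (R := R) y).
Proof. by have := norm_coord_le_norm1 (vec_of_count y) i; rewrite mxE normr_nat. Qed.

Lemma ln_le_subr1 (x : R) : 0 < x -> ln x <= x - 1.
Proof.
by move=> x0; have := @le_ln1Dx R (x - 1); rewrite (addrC 1) subrK; apply; lra.
Qed.

Lemma ln_sub_le (a b : R) : 0 < a -> 0 < b -> ln a - ln b <= (a - b) / b.
Proof.
move=> a0 b0; rewrite -ln_div ?posrE//.
by rewrite (le_trans (ln_le_subr1 _)) ?divr_gt0// mulrBl divff ?gt_eqF.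
Qed.

(** Strictness comes from [1 + x < expR x] for nonzero [x]. It makes the Poisson divergence vanish
    only at equal means. *)
Lemma ln_sub_lt (a b : R) : 0 < a -> 0 < b -> a != b ->
  ln a - ln b < (a - b) / b.
Proof.
move=> a0 b0 ab; have /expR_gt1Dx : ln a - ln b != 0.
  by apply: contra_neq ab => /subr0_eq /ln_inj; rewrite !posrE; exact.
rewrite expRB !lnK ?posrE// mulrBl divff ?gt_eqF//.
by rewrite ltrBrDl.
Qed.

Variable c : R.
Hypothesis c0 : 0 < c.

Lemma dist_ln_le (a b : R) : c <= a -> c <= b -> `|ln a - ln b| <= `|a - b| / c.
Proof.
have H (u v : R) : c <= u -> c <= v -> ln u - ln v <= `|u - v| / c.
  move=> cu cv; have v0 := lt_le_trans c0 cv.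
  rewrite (le_trans (ln_sub_le (lt_le_trans c0 cu) v0))//.
  rewrite (le_trans (ler_wpM2r _ (ler_norm _))) ?invr_ge0 ?(ltW v0)//.
  by rewrite ler_wpM2l ?normr_ge0// lef_pV2 ?posrE.
move=> ca cb; rewrite ler_norml lerNl opprB H// andbT.
by rewrite distrC H.
Qed.

Lemma loglik_coord_lipschitz (n : nat) (a b : R) : c <= a -> c <= b ->
  `|(n%:R * ln a - a) - (n%:R * ln b - b)| <= (n%:R / c + 1) * `|a - b|.
Proof.
move=> ca cb; rewrite [X in `|X|](_ : _ = n%:R * (ln a - ln b) - (a - b)); last ring.
rewrite (le_trans (ler_normB _ _))// mulrDl mul1r lerD2r normrM normr_nat.
by rewrite mulrAC -mulrA ler_wpM2l// dist_ln_le.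
Qed.

Lemma loglik_lipschitz y l l' :
  (forall i, c <= l 0 i) -> (forall i, c <= l' 0 i) ->
  `|poisson_loglik y l - poisson_loglik y l'| <=
  (norm1 (vec_of_count (R := R) y) / c + 1) * norm1 (l - l').
Proof.
move=> cl cl'; rewrite /poisson_loglik -sumrB (le_trans (ler_norm_sum _ _ _))//.
rewrite {2}/norm1 mulr_sumr; apply: ler_sum => i _.
rewrite (le_trans (loglik_coord_lipschitz _ (cl i) (cl' i)))// !mxE.
rewrite ler_wpM2r ?normr_ge0// lerD2r ler_pM2r ?invr_gt0//.
exact: count_le_norm1.
Qed.

(** A bound free of [l], for the finitely many initial times that the truncation argument does not
    reach. It follows from the tangent to [ln] at [n + 1], a point that stays positive for
    [n = 0]. *)
Lemma loglik_le_count y l : (forall i, c <= l 0 i) ->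
  poisson_loglik y l <= \sum_(i < m) (tnth y i)%:R * ln ((tnth y i).+1)%:R.
Proof.
move=> cl; apply: ler_sum => i _.
have l0 : 0 < l 0 i := lt_le_trans c0 (cl i).
set n := tnth y i; have n0 : 0 < (n.+1%:R : R) by rewrite ltr0n.
have := ler_wpM2l (ler0n R n) (ln_sub_le l0 n0).
rewrite mulrBr lerBlDr => h; rewrite lerBlDr (le_trans h)// addrC lerD2l.
rewrite mulrA ler_pdivrMr// -natr1.
have := mulr_ge0 (ler0n R n) (ler0n R n); have := ler0n R n.
by move: l0; set x := l 0 i; set z := n%:R; move=> *; nra.
Qed.

End poisson_loglik.

Section truncation.
Context {m : nat}.
Implicit Types (y : nat -> m.-tuple nat) (x : m.-tuple nat).

Definition cap_count (K : nat) x : m.-tuple nat :=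
  [tuple minn (tnth x i) K | i < m].

Definition trunc (K : nat) y : nat -> m.-tuple nat :=
  fun k => if (k < K)%N then cap_count K (y k) else count0.

(** A truncated sequence is coded by [K] tuples with entries at most [K]. Finiteness is what turns
    continuity in theta at each sequence into closeness uniform over truncated sequences. *)
Lemma trunc_finite K : exists (I : finType) (z : I -> nat -> m.-tuple nat),
  forall y, exists i, trunc K y = z i.
Proof.
pose decode (z : {ffun 'I_K -> m.-tuple 'I_K.+1}) (k : nat) : m.-tuple nat :=
  if insub k is Some j then map_tuple (@nat_of_ord _) (z j) else count0.
exists {ffun 'I_K -> m.-tuple 'I_K.+1}, decode => y.
exists [ffun j : 'I_K => [tuple inord (minn (tnth (y j) i) K) | i < m]].
apply/funext => k; rewrite /decode /trunc; case: insubP => [j jK <-|/negbTE -> //].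
rewrite ltn_ord ffunE; apply: eq_from_tnth => i.
by rewrite [LHS]tnth_mktuple [RHS]tnth_map tnth_mktuple inordK// ltnS geq_minr.
Qed.

Context {R : realType}.

Lemma norm1_cap_count K x :
  norm1 (vec_of_count (R := R) x - vec_of_count (cap_count K x))
  <= norm1 (vec_of_count (R := R) x).
Proof.
apply: ler_sum => i _; rewrite !mxE tnth_mktuple normr_nat -natrB ?geq_minl//.
by rewrite normr_nat ler_nat leq_subr.
Qed.

Lemma vec_of_count0 : vec_of_count (R := R) (count0 : m.-tuple nat) = 0.
Proof. by apply/rowP => i; rewrite !mxE tnth_mktuple. Qed.

Lemma norm1_trunc K y k :
  norm1 (vec_of_count (R := R) (y k) - vec_of_count (trunc K y k))
  <= norm1 (vec_of_count (R := R) (y k)).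
Proof.
rewrite /trunc; case: ifPn => _; first exact: norm1_cap_count.
by rewrite vec_of_count0 subr0.
Qed.

Lemma trunc_id K y k : (k < K)%N ->
  norm1 (vec_of_count (R := R) (y k)) <= K%:R -> trunc K y k = y k.
Proof.
move=> kK yK; rewrite /trunc kK; apply: eq_from_tnth => i.
rewrite tnth_mktuple; apply/minn_idPl.
by rewrite -(ler_nat R) (le_trans (count_le_norm1 _ _)).
Qed.

End truncation.

Section lipschitz_series.
Context {R : realType} {m : nat}.
Variable a : nat -> R.
Hypothesis a0 : forall k, 0 <= a k.
Implicit Types y z : nat -> m.-tuple nat.

Local Notation vec := (vec_of_count (R := R)).

(* [a k] plays the role of alpha_(k+1), as [y k] encodes y_(k+1). *)
Definition lip y z : \bar R :=
  \sum_(0 <= k <oo) (a k * norm1 (vec (y k) - vec (z k)))%:E.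

Lemma lip_term_ge0 y z k : (0 <= (a k * norm1 (vec (y k) - vec (z k)))%:E)%E.
Proof. by rewrite lee_fin mulr_ge0// norm1_ge0. Qed.

Lemma lip_ge0 y z : (0 <= lip y z)%E.
Proof. by apply: nneseries_ge0 => k _ _; exact: lip_term_ge0. Qed.

Lemma le_lip y z y' z' :
  (forall k, norm1 (vec (y k) - vec (z k)) <= norm1 (vec (y' k) - vec (z' k))) ->
  (lip y z <= lip y' z')%E.
Proof.
move=> h; apply: lee_nneseries => k *; first exact: lip_term_ge0.
by rewrite lee_fin ler_wpM2l.
Qed.

Lemma lip_trunc_le K y : (lip y (trunc K y) <= lip y (fun=> count0))%E.
Proof. by apply: le_lip => k; rewrite vec_of_count0 subr0 norm1_trunc. Qed.

(** For fixed [N], the first [N] coordinates are left intact once [K] exceeds [N] and all their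
    counts. The other coordinates contribute at most the tail from [N] of a convergent series. *)
Lemma lip_trunc_cvg y : (lip y (fun=> count0) < +oo)%E ->
  lip y (trunc K y) @[K --> \oo] --> 0%E.
Proof.
move=> lip_fin.
pose F k := (a k * norm1 (vec (y k)))%:E.
have F0 k : (0 <= F k)%E by rewrite lee_fin mulr_ge0// norm1_ge0.
have tailF : (\sum_(N <= k <oo) F k)%E @[N --> \oo] --> 0%E.
  apply: nneseries_tail_cvg => //; apply: le_lt_trans lip_fin.
  by apply: lee_nneseries => // k _; rewrite vec_of_count0 subr0.
have head K N : (\max_(k < N) \sum_(i < m) tnth (y k) i <= K)%N -> (N <= K)%N ->
    (lip y (trunc K y) <= \sum_(N <= k <oo) F k)%E.
  move=> maxK NK; rewrite /lip (nneseries_split 0 N); last first.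
    by move=> k _; exact: lip_term_ge0.
  rewrite add0n big_nat big1 ?add0e => [|k /andP[_ kN]].
    apply: lee_nneseries => k *; first exact: lip_term_ge0.
    by rewrite lee_fin ler_wpM2l// norm1_trunc.
  rewrite (@trunc_id _ R) ?(leq_trans kN)//; first by rewrite subrr norm10 mulr0.
  rewrite norm1_vec_of_count -natr_sum ler_nat (leq_trans _ maxK)//.
  exact: (leq_bigmax (Ordinal kN)).
have lipfin K : lip y (trunc K y) \is a fin_num.
  by rewrite ge0_fin_numE ?lip_ge0// (le_lt_trans (lip_trunc_le K y)).
apply/fine_cvgP; split; first exact: nearW.
have /fine_cvgP[tailfin /cvgr0Pnorm_le tail0] := tailF.
apply/cvgr0Pnorm_le => e e0.
have [N [Nfin /= hN]] : exists N, (\sum_(N <= k <oo) F k)%E \is a fin_num /\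
    `|fine (\sum_(N <= k <oo) F k)%E| <= e.
  by apply: (@filter_ex _ \oo); near=> N; split; near: N => //; exact: tail0.
near=> K; rewrite /= ger0_norm ?fine_ge0 ?lip_ge0//.
apply: le_trans hN; apply: le_trans (ler_norm _).
rewrite fine_le// head//; near: K; exact: nbhs_infty_ge.
Unshelve. all: by end_near. Qed.

End lipschitz_series.

(** * Measurability and moments *)

(** The tuple type is countable and its singletons are measurable, so all its subsets are. *)
Lemma measurable_count {m : nat} {d : measure_display} {T : measurableType d}
  (F : m.-tuple nat -> T) : measurable_fun setT F.
Proof.
move=> _ A _; rewrite setTI.
apply: countable_measurable => [x|]; last exact: countableP.
have -> : [set x] = \bigcap_(i in [set: 'I_m])
    ((fun y : m.-tuple nat => tnth y i) @^-1` [set tnth x i]).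
  apply/seteqP; split=> [y -> //|y xy]; apply: eq_from_tnth => i; exact: xy.
apply: fin_bigcap_measurable => // i _.
by rewrite -[X in measurable X]setTI; exact: measurable_tnth.
Qed.

(** As [1 + eps >= 2], the square is at most 1 where [|X| <= 1] and at most [|X|] to the power
    [1 + eps] elsewhere. *)
Lemma square_moment_of_Lnorm {d : measure_display} {T : measurableType d}
    {R : realType} (P : probability T R) (X : T -> R) (eps C : R) :
  measurable_fun setT X -> 1 <= eps ->
  ('N[P]_((1 + eps)%:E)[(fun w => (X w)%:E)] < C%:E)%E ->
  (\int[P]_w (X w ^+ 2)%:E <= (1 + C `^ (1 + eps))%:E)%E.
Proof.
move=> mX eps1 XC.
have e0 : 0 < 1 + eps by rewrite ltr_pwDl// (le_trans ler01).
have mXp : measurable_fun setT (fun w => `|(X w)%:E| `^ (1 + eps))%E.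
  apply: (measurableT_comp (measurable_poweR (1 + eps))).
  by apply: measurableT_comp => //; exact/measurable_EFinP.
have XC' : (\int[P]_w (`|(X w)%:E| `^ (1 + eps))%E <= (C `^ (1 + eps))%:E)%E.
  rewrite -powR_Lnorm ?gt_eqF// -poweR_EFin; apply: gt0_ler_poweR.
  - exact: ltW.
  - by rewrite in_itv /= Lnorm_ge0 leey.
  - by rewrite in_itv /= leey andbT (le_trans _ (ltW XC))// Lnorm_ge0.
  - exact: ltW.
apply: (@le_trans _ _ (\int[P]_w (1 + `|(X w)%:E| `^ (1 + eps)))%E); last first.
  rewrite ge0_integralD//; last by move=> w _; exact: poweR_ge0.
  rewrite EFinD leeD// integral_cst// mul1e.
  exact: probability_le1.
apply: ge0_le_integral => //.
- by move=> w _; rewrite lee_fin sqr_ge0.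
- by apply/measurable_EFinP; exact: measurable_funX.
- exact: emeasurable_funD.
- move=> w _.
  rewrite abse_EFin poweR_EFin -EFinD lee_fin -real_normK ?num_real//.
  have [X1|X1] := leP `|X w| 1.
    by rewrite (le_trans (exprn_ile1 _ (normr_ge0 _) X1)) ?lerDl ?powR_ge0 ?normr_ge0.
  rewrite (@le_trans _ _ (`|X w| `^ (1 + eps)))// ?lerDr//.
  by rewrite -powR_mulrn// ler_powR ?(ltW X1)// (natrD _ 1 1) lerD2l.
Qed.

Local Notation count_path m := (g_sigma_algebraType
  (\bigcup_(i in [set: int]) preimage_set_system setT
     (fun y : int -> m.-tuple nat => y i) measurable)).

Section path_functionals.
Context {R : realType} {m : nat}.

Local Notation E := (m.-tuple nat).
Local Notation path := (count_path m).
Local Notation vec := (vec_of_count (R := R)).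

Lemma measurable_path_coord {d : measure_display} {T : measurableType d}
  (F : E -> T) (t : int) : measurable_fun setT (fun y : path => F (y t)).
Proof.
apply: (measurableT_comp (measurable_count F)).
move=> _ B mB; rewrite setTI; apply: sub_sigma_algebra.
by exists t => //; exists B => //; rewrite setTI.
Qed.

Lemma measurable_path_past (F : (nat -> E) -> R) (t : int) :
  measurable_wrt (product_sigma E nat) F ->
  measurable_fun setT (fun y : path => F (past_seq y t)).
Proof.
move=> mF; apply/measurable_wrtT => B mB.
apply: (sigma_gen_preimage (phi := fun y : path => past_seq y t)
  (sigma_algebra_measurable path) _ (mF _ mB)) => k _.
apply/measurable_wrtT; exact: (measurable_path_coord idfun).
Qed.

Lemma measurable_path_loglik (F : (nat -> E) -> 'rV[R]_m) (t : int) :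
  (forall i, measurable_wrt (product_sigma E nat) (fun y => F y 0 i)) ->
  measurable_fun setT (fun y : path => poisson_loglik (y t) (F (past_seq y t))).
Proof.
move=> mF; apply: measurable_sum => i.
have mFi := measurable_path_past t (mF i).
apply: measurable_funB => //.
apply: measurable_funM.
  exact: (measurable_path_coord (fun x : E => (tnth x i)%:R : R)).
exact: (measurableT_comp (@measurable_ln R) mFi).
Qed.

Lemma measurable_path_lip (a : nat -> R) (F : nat -> E -> E) (t : int) :
  (forall k, 0 <= a k) ->
  measurable_fun setT (fun y : path =>
    lip a (past_seq y t) (fun k => F k (past_seq y t k))).
Proof.
move=> a0; apply: (@ge0_emeasurable_sum _ _ _ _ _ predT).
  by move=> k y _ _; rewrite lee_fin mulr_ge0// norm1_ge0.
move=> k _; apply/measurable_EFinP.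
exact: (measurable_path_coord (fun x : E => a k * norm1 (vec x - vec (F k x)))).
Qed.

End path_functionals.

Section moments.
Context {dO : measure_display} {Omega : measurableType dO} {R : realType}.
Variable P : probability Omega R.
Context {m : nat}.
Local Notation E := (m.-tuple nat).
Local Notation path := (count_path m).
Local Notation vec := (vec_of_count (R := R)).

Variable Y : int -> Omega -> E.
Hypothesis mY : forall t, measurable_fun setT (Y t).
Variable M : R.
Hypothesis momentY : forall t,
  (\int[P]_w (norm1 (vec (Y t w)) ^+ 2)%:E <= M%:E)%E.
Variable a : nat -> R.
Hypothesis a0 : forall k, 0 <= a k.
Hypothesis suma : (\sum_(0 <= k <oo) (a k)%:E < +oo)%E.
Variable c : R.
Hypothesis c0 : 0 < c.

Lemma measurable_comp_trajectory {d : measure_display} {T : measurableType d}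
  (g : path -> T) : measurable_fun setT g ->
  measurable_fun setT (fun w => g (trajectory Y w)).
Proof.
move=> mg; apply/measurable_wrtT => B mB.
apply: (measurable_trajectory mY (A := g @^-1` B)).
by rewrite -[X in product_sigma _ _ X]setTI; exact: mg.
Qed.

(** A Lipschitz constant, for [norm1], of the log-likelihood at [x] over means that are at least
    [c]. *)
Definition lip_weight (x : E) : R := norm1 (vec x) / c + 1.

Lemma lip_weight_ge1 x : 1 <= lip_weight x.
Proof. by rewrite /lip_weight lerDr divr_ge0 ?norm1_ge0// ltW. Qed.

Lemma lip_weight_ge0 x : 0 <= lip_weight x.
Proof. exact: le_trans (lip_weight_ge1 x). Qed.

Let N t w := norm1 (vec (Y t w)).
Let V t w := lip a (past_seq (trajectory Y w) t) (fun=> count0).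

Let mF t (F : E -> R) : measurable_fun setT (fun w => F (Y t w)).
Proof. exact: (measurableT_comp (measurable_count F) (mY t)). Qed.

Let mN t : measurable_fun setT (N t).
Proof. exact: (mF t (fun x => norm1 (vec x))). Qed.

Let mV t : measurable_fun setT (V t).
Proof.
exact: (measurable_comp_trajectory (measurable_path_lip (fun=> fun=> count0) t a0)).
Qed.

Let V0 t w : (0 <= V t w)%E. Proof. exact: lip_ge0. Qed.

Let le_integral_quadratic (q : Omega -> R) (A B D : R) (s t : int) :
  measurable_fun setT q -> (forall w, 0 <= q w) -> 0 <= A -> 0 <= B -> 0 <= D ->
  (forall w, q w <= A * N s w ^+ 2 + B * N t w ^+ 2 + D) ->
  (\int[P]_w (q w)%:E <= (A * M + B * M + D)%:E)%E.
Proof.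
move=> mq q0 A0 B0 D0 qle.
have m2 r : measurable_fun setT (fun w => (N r w ^+ 2)%:E).
  by apply/measurable_EFinP; apply: measurable_funX; exact: mN.
have N2 r w : (0 <= (N r w ^+ 2)%:E)%E by rewrite lee_fin sqr_ge0.
have mBN r (B' : R) : measurable_fun setT (fun w => B'%:E * (N r w ^+ 2)%:E)%E.
  exact: measurable_funeM.
have nn r w B' : 0 <= B' -> (0 <= B'%:E * (N r w ^+ 2)%:E)%E.
  by move=> ?; rewrite mule_ge0.
apply: (@le_trans _ _ (\int[P]_w (A%:E * (N s w ^+ 2)%:E +
    B%:E * (N t w ^+ 2)%:E + D%:E))%E).
  apply: ge0_le_integral => //.
  - by move=> w _; rewrite lee_fin.
  - exact/measurable_EFinP.
  - by apply: emeasurable_funD => //; exact: emeasurable_funD.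
  - by move=> w _; rewrite -!EFinM -!EFinD lee_fin.
rewrite ge0_integralD//; last 2 first.
- by move=> w _; rewrite adde_ge0 ?nn.
- exact: emeasurable_funD.
rewrite ge0_integralD//; last 2 first.
- by move=> w _; rewrite nn.
- by move=> w _; rewrite nn.
rewrite !ge0_integralZl_EFin// integral_cst// !EFinD !EFinM.
rewrite leeD ?leeD ?lee_wpmul2l ?lee_fin ?momentY//.
rewrite -[leRHS]mule1 lee_wpmul2l ?lee_fin//; exact: probability_le1.
Qed.

(** The weight is linear in [Y t] and the series is linear in the past counts. Each product of two
    counts is bounded by their squares, whose means are bounded uniformly in time, and the
    coefficients [a k] are summable. *)
Lemma integral_weight_lip_lty (t : int) :
  (\int[P]_w ((lip_weight (Y t w))%:E *
     (lip a (past_seq (trajectory Y w) t) (fun=> count0) + 1)) < +oo)%E.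
Proof.
set W := fun w => lip_weight (Y t w).
have mW : measurable_fun setT W by exact: (mF t lip_weight).
have mWE : measurable_fun setT (EFin \o W) by exact/measurable_EFinP.
(* This is [(x + 1)^2 <= 2 x^2 + 2] with [x = N t w / c]. *)
have W2 w : W w ^+ 2 <= 2 / c ^+ 2 * N t w ^+ 2 + 2.
  rewrite (_ : _ * _ = 2 * (N t w / c) ^+ 2); last by rewrite exprMn exprVn; ring.
  by rewrite /W /lip_weight -/(N t w); move: (_ / c) => x;
    have := sqr_ge0 (x - 1); nra.
have cc : 0 <= 2 / c ^+ 2 by rewrite divr_ge0 ?sqr_ge0.
rewrite (eq_integral (fun w => (W w)%:E * V t w + (W w)%:E)%E); last first.
  by move=> w _; rewrite ge0_muleDr ?mule1//; exact: V0.
have W0 w : 0 <= W w by exact: lip_weight_ge0.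
have WV0 w : (0 <= (W w)%:E * V t w)%E by rewrite mule_ge0 ?lee_fin.
rewrite ge0_integralD//; last 2 first.
- by apply: emeasurable_funM => //; exact: mV.
- by move=> w _; rewrite lee_fin.
have WW w : W w <= W w ^+ 2.
  by rewrite expr2 ler_peMr//; exact: lip_weight_ge1.
apply: lte_add_pinfty; last first.
  apply: le_lt_trans (ltry (2 / c ^+ 2 * M + 0 * M + 2)).
  apply: (le_integral_quadratic (s := t) (t := t)) => // w.
  by rewrite mul0r addr0 (le_trans (WW w)).
pose q k w := W w * (a k * N (t - k.+1%:Z) w).
have mq k : measurable_fun setT (q k).
  apply: measurable_funM => //; apply: measurable_funM; first exact: measurable_cst.
  exact: mN.
have q0 k w : 0 <= q k w.
  by rewrite !mulr_ge0// norm1_ge0.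
have -> : (\int[P]_w ((W w)%:E * V t w) =
    \int[P]_w \sum_(0 <= k <oo) (q k w)%:E)%E.
  apply: eq_integral => w _; rewrite /V /lip -nneseriesZl.
    by apply: eq_eseriesr => k _; rewrite vec_of_count0 subr0.
  by move=> k _; exact: lip_term_ge0.
rewrite integral_nneseries//; last 2 first.
- by move=> k; exact/measurable_EFinP.
- by move=> k w _; rewrite lee_fin.
(* [K] bounds the mean of [W * N (t - k - 1)] for every [k]: the outer terms bound the mean of
   [W^2], the middle one that of [N^2]. *)
pose K := 2 / c ^+ 2 * M + 1 * M + 2.
apply: (@le_lt_trans _ _ (K%:E * \sum_(0 <= k <oo) (a k)%:E)%E); last first.
  have M0 : 0 <= M.
    rewrite -lee_fin (le_trans _ (momentY 0))// integral_ge0// => w _.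
    by rewrite lee_fin sqr_ge0.
  by rewrite lte_mul_pinfty// lee_fin !addr_ge0// mulr_ge0.
rewrite -nneseriesZl//; last by move=> k _; rewrite lee_fin.
apply: lee_nneseries => k; first by move=> *; apply: integral_ge0 => w _; rewrite lee_fin.
move=> _; rewrite (_ : K%:E * _ =
    (a k * (2 / c ^+ 2) * M + a k * M + a k * 2)%:E)%E; last first.
  by rewrite -EFinM; congr EFin; rewrite /K; ring.
apply: (le_integral_quadratic (s := t) (t := t - k.+1%:Z)) => //; try by rewrite mulr_ge0.
move=> w; rewrite /q; move: (W2 w) (W0 w) (a0 k).
set x := W w; set y := N (t - _) w; set z := 2 / _ * _ => x2 x0 ak0.
have xy : x * y <= x ^+ 2 + y ^+ 2.
  have := sqr_ge0 (x - y); have := sqr_ge0 x; have := sqr_ge0 y; nra.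
rewrite [leRHS](_ : _ = a k * (z + y ^+ 2 + 2)); last by rewrite /z; ring.
by rewrite mulrCA ler_wpM2l//; move: x2 xy; lra.
Qed.

End moments.

(** * The contrast has negative mean *)

Section contrast.
Context {dO : measure_display} {Omega : measurableType dO} {R : realType}.
Variable P : probability Omega R.
Context {m : nat}.
Local Notation E := (m.-tuple nat).
Local Notation vec := (vec_of_count (R := R)).

Variable Y : int -> Omega -> E.
Hypothesis mY : forall t, measurable_fun setT (Y t).
Variable M : R.
Hypothesis momentY : forall t,
  (\int[P]_w (norm1 (vec (Y t w)) ^+ 2)%:E <= M%:E)%E.
Variable a : nat -> R.
Hypothesis a0 : forall k, 0 <= a k.
Hypothesis suma : (\sum_(0 <= k <oo) (a k)%:E < +oo)%E.
Variable c : R.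
Hypothesis c0 : 0 < c.

(** The common integrable envelope: up to a constant it dominates the contrast and the truncation
    penalty. *)
Definition weight_lip (t : int) (w : Omega) : \bar R :=
  ((lip_weight c (Y t w))%:E *
     (lip a (past_seq (trajectory Y w) t) (fun=> count0) + 1))%E.

Lemma lip1_ge0 (y z : nat -> E) : (0 <= lip a y z + 1)%E.
Proof. by rewrite adde_ge0 ?lip_ge0. Qed.

Lemma weight_lip_ge0 t w : (0 <= weight_lip t w)%E.
Proof. by rewrite mule_ge0 ?lip1_ge0// lee_fin (lip_weight_ge0 c0). Qed.

Lemma integrable_weight_lip t : P.-integrable setT (weight_lip t).
Proof.
apply/integrableP; split.
  apply: emeasurable_funM.
    by apply/measurable_EFinP; exact: (measurableT_comp (measurable_count _) (mY t)).
  apply: emeasurable_funD => //.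
  exact: (measurable_comp_trajectory mY (measurable_path_lip (fun=> fun=> count0) t a0)).
rewrite (eq_integral (weight_lip t)); last by move=> w _; rewrite gee0_abs ?weight_lip_ge0.
exact: (integral_weight_lip_lty mY momentY a0 suma c0 t).
Qed.

Lemma integrable_le_weight_lip t (B : R) (g : Omega -> R) :
  measurable_fun setT g -> (forall w, (`|g w|%:E <= B%:E * weight_lip t w)%E) ->
  P.-integrable setT (EFin \o g).
Proof.
move=> mg gB.
have iB := integrableZl measurableT B (integrable_weight_lip t).
apply: le_integrable iB => //; first exact/measurable_EFinP.
by move=> w _ /=; rewrite (le_trans (gB w))// lee_abs.
Qed.

(** The weight is at least 1, so the series is below the integrable [weight_lip]. *)
Lemma ae_lip_fin t : {ae P, forall w,
  (lip a (past_seq (trajectory Y w) t) (fun=> count0) < +oo)%E}.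
Proof.
have := integrable_ae measurableT (integrable_weight_lip t).
apply: filterS => w /(_ I); rewrite ge0_fin_numE ?weight_lip_ge0//.
apply: le_lt_trans; rewrite /weight_lip.
apply: (@le_trans _ _ (lip a (past_seq (trajectory Y w) t) (fun=> count0) + 1)%E).
  by rewrite leeDl.
by rewrite -[leLHS]mul1e lee_wpmul2r ?lip1_ge0// lee_fin (lip_weight_ge1 c0).
Qed.

Definition lipschitz_in_past (g : (nat -> E) -> 'rV[R]_m) :=
  forall y z, ((norm1 (g y - g z))%:E <= lip a y z)%E.

Variables f1 f0 : (nat -> E) -> 'rV[R]_m.
Hypothesis lip_f1 : lipschitz_in_past f1.
Hypothesis lip_f0 : lipschitz_in_past f0.
Hypothesis c_f1 : forall y i, c <= f1 y 0 i.
Hypothesis c_f0 : forall y i, c <= f0 y 0 i.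
Hypothesis m_f1 : forall i, measurable_wrt (product_sigma E nat) (fun y => f1 y 0 i).
Hypothesis m_f0 : forall i, measurable_wrt (product_sigma E nat) (fun y => f0 y 0 i).

Lemma lipC (y z : nat -> E) : lip a y z = lip a z y.
Proof. by apply: eq_eseriesr => k _; rewrite norm1_distC. Qed.

(** Passing from [f1 y] to [f0 y] through the values of [f1] and [f0] at the zero sequence costs the
    series twice and a constant. *)
Lemma dist_le_lip1 y : ((norm1 (f1 y - f0 y))%:E <=
  (2 + norm1 (f1 (fun=> count0) - f0 (fun=> count0)))%:E *
  (lip a y (fun=> count0) + 1))%E.
Proof.
have L1 := lip_f1 y (fun=> count0).
have L0 := lip_f0 (fun=> count0) y; rewrite lipC in L0.
set B := norm1 (f1 (fun=> count0) - f0 (fun=> count0)).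
have B0 : 0 <= B by exact: norm1_ge0.
have lip0 := lip_ge0 a0 y (fun=> count0).
have : ((norm1 (f1 y - f0 y))%:E <=
    lip a y (fun=> count0) + B%:E + lip a y (fun=> count0))%E.
  apply: le_trans (leeD (leeD L1 (lexx B%:E)) L0).
  rewrite -!EFinD lee_fin (le_trans (ler_norm1_dist _ (f1 (fun=> count0)) _))//.
  rewrite -addrA lerD2l; exact: ler_norm1_dist.
move/le_trans; apply.
move: lip0; case: (lip _ _ _) => [r||] //= r0.
  by rewrite -!EFinD -EFinM lee_fin; move: r0; rewrite lee_fin => r0; nra.
by rewrite [in leRHS]addye// gt0_muley ?leey// lte_fin ltr_pwDl.
Qed.

Variable t : int.
Let past w := past_seq (trajectory Y w) t.

Let integrable_le_dist (g : Omega -> R) : measurable_fun setT g ->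
  (forall w, `|g w| <= lip_weight c (Y t w) * norm1 (f1 (past w) - f0 (past w))) ->
  P.-integrable setT (EFin \o g).
Proof.
move=> mg gle.
apply: (integrable_le_weight_lip (t := t)
  (B := 2 + norm1 (f1 (fun=> count0) - f0 (fun=> count0)))) => // w.
rewrite (@le_trans _ _ (lip_weight c (Y t w) * norm1 (f1 (past w) - f0 (past w)))%:E)//.
  by rewrite lee_fin.
rewrite /weight_lip muleCA EFinM lee_wpmul2l ?dist_le_lip1//.
by rewrite lee_fin (lip_weight_ge0 c0).
Qed.

Definition contrast (w : Omega) : R :=
  poisson_loglik (Y t w) (f1 (past w)) - poisson_loglik (Y t w) (f0 (past w)).

Let mcomp (g : (nat -> E) -> R) : measurable_wrt (product_sigma E nat) g ->
  measurable_fun setT (fun w => g (past w)).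
Proof.
move=> mg.
exact: (measurable_comp_trajectory mY (measurable_path_past t mg)).
Qed.

Let mcount i : measurable_fun setT (fun w => (tnth (Y t w) i)%:R : R).
Proof.
exact: (measurableT_comp
  (measurable_count (fun x : E => (tnth x i)%:R : R)) (mY t)).
Qed.

Lemma integrable_contrast : P.-integrable setT (EFin \o contrast).
Proof.
apply: integrable_le_dist => [|w].
  apply: measurable_funB.
    exact: (measurable_comp_trajectory mY (measurable_path_loglik t m_f1)).
  exact: (measurable_comp_trajectory mY (measurable_path_loglik t m_f0)).
exact: loglik_lipschitz.
Qed.

Let h i w := ln (f1 (past w) 0 i) - ln (f0 (past w) 0 i).
Let l1 i w := f1 (past w) 0 i.
Let l0 i w := f0 (past w) 0 i.
Let y i w : R := (tnth (Y t w) i)%:R.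

Let l1_gt0 i w : 0 < l1 i w. Proof. exact: lt_le_trans (c_f1 _ _). Qed.
Let l0_gt0 i w : 0 < l0 i w. Proof. exact: lt_le_trans (c_f0 _ _). Qed.

Let ml1 i : measurable_fun setT (l1 i). Proof. exact: (mcomp (m_f1 i)). Qed.
Let ml0 i : measurable_fun setT (l0 i). Proof. exact: (mcomp (m_f0 i)). Qed.

Let mh i : measurable_fun setT (h i).
Proof.
by apply: measurable_funB; apply: (measurableT_comp (@measurable_ln R));
  [exact: ml1|exact: ml0].
Qed.

Let sigma_past : sigma_algebra setT (past_sigma Y t).
Proof. exact: smallest_sigma_algebra. Qed.

Let past_sub : past_sigma Y t `<=` measurable.
Proof.
apply: smallest_sub; first exact: sigma_algebra_measurable.
by move=> _ [s _ [B mB <-]]; exact: mY.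
Qed.

Let past_comp (g : (nat -> E) -> R) : measurable_wrt (product_sigma E nat) g ->
  measurable_wrt (past_sigma Y t) (fun w => g (past w)).
Proof.
move=> mg B mB; apply: (sigma_gen_preimage sigma_past _ (mg B mB)) => k _ A mA.
apply: sub_sigma_algebra; exists (t - k.+1%:Z); first by rewrite /= ltrBlDr ltrDl.
by exists A => //; rewrite setTI.
Qed.

Let hG i : measurable_wrt (past_sigma Y t) (h i).
Proof.
have mm (g : (nat -> E) -> R) : measurable_wrt (product_sigma E nat) g ->
    measurable_fun setT
      ((fun w => g (past w)) : g_sigma_algebraType (past_sigma Y t) -> R).
  move=> mg; apply/measurable_wrtT => B mB.
  by rewrite (measurable_g_measurableTypeE sigma_past); exact: past_comp.
have : measurable_fun setT (h i : g_sigma_algebraType (past_sigma Y t) -> R).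
  by apply: measurable_funB; apply: (measurableT_comp (@measurable_ln R));
    [exact: (mm _ (m_f1 i))|exact: (mm _ (m_f0 i))].
move=> /measurable_wrtT mhi B mB.
by have := mhi B mB; rewrite (measurable_g_measurableTypeE sigma_past).
Qed.

Hypothesis condY : forall i, is_cond_exp P (past_sigma Y t) (y i) (l0 i).

Let dist_coord i w : `|l1 i w - l0 i w| <=
  lip_weight c (Y t w) * norm1 (f1 (past w) - f0 (past w)).
Proof.
rewrite (@le_trans _ _ (norm1 (f1 (past w) - f0 (past w))))//.
  by have := norm_coord_le_norm1 (f1 (past w) - f0 (past w)) i; rewrite !mxE.
by rewrite ler_peMl ?norm1_ge0// (lip_weight_ge1 c0).
Qed.

Let integrable_dist i : P.-integrable setT (fun w => (l1 i w - l0 i w)%:E).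
Proof.
apply: (integrable_le_dist (g := fun w => l1 i w - l0 i w)) => [|w].
  by apply: measurable_funB; [exact: ml1|exact: ml0].
exact: dist_coord.
Qed.

Let integrable_yh i : P.-integrable setT (fun w => (h i w * y i w)%:E).
Proof.
apply: (integrable_le_dist (g := fun w => h i w * y i w)) => [|w].
  by apply: measurable_funM; [exact: mh|exact: mcount].
rewrite normrM (@ger0_norm _ (y i w)) ?ler0n// /lip_weight.
have := dist_ln_le c0 (c_f1 (past w) i) (c_f0 (past w) i).
have := norm_coord_le_norm1 (f1 (past w) - f0 (past w)) i; rewrite !mxE.
have : y i w <= norm1 (vec (Y t w)) := count_le_norm1 _ _.
have : 0 <= y i w := ler0n _ _.
have : 0 <= `|l1 i w - l0 i w| := normr_ge0 _.
rewrite -/(h i w) -/(l1 i w) -/(l0 i w).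
set n1 := norm1 _; set n2 := norm1 _; set u := `|_ - _|; set v := y i w.
move=> u0 v0 vn un hu.
rewrite (@le_trans _ _ (u / c * v)) ?ler_wpM2r//.
rewrite mulrDl mul1r (@le_trans _ _ (n1 / c * n2)) ?lerDl ?norm1_ge0//.
rewrite -mulrA [in leRHS]mulrC ler_pM// ?mulr_ge0 ?invr_ge0 ?(ltW c0)//.
by rewrite mulrC ler_wpM2r// invr_ge0 ltW.
Qed.

(** Both factors may grow with the past, so the envelope does not apply directly. Integrability is
    transferred from [h * y], because [l0] is the conditional mean of [y] and [|h|] is measurable
    with respect to the past. *)
Let integrable_l0h i : P.-integrable setT (fun w => (h i w * l0 i w)%:E).
Proof.
apply/integrableP; split.
  by apply/measurable_EFinP; apply: measurable_funM; [exact: mh|exact: ml0].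
have /integrableP[_] := integrable_yh i.
have ab (q : Omega -> R) : (forall w, 0 <= q w) ->
    (\int[P]_w `|(h i w * q w)%:E| = \int[P]_w (`|h i w| * q w)%:E)%E.
  by move=> q0; apply: eq_integral => w _; rewrite abse_EFin normrM (ger0_norm (q0 w)).
rewrite !ab => [|w|w]; [|exact: ltW|exact: ler0n].
rewrite (ge0_integral_mul_cond_exp sigma_past past_sub (condY i))//.
- move=> B mB; have mB' : measurable ((fun x : R => `|x|) @^-1` B).
    by rewrite -[X in measurable X]setTI; exact: normr_measurable.
  exact: (hG i mB').
- by move=> w; exact: ltW.
Qed.

(** The Kullback-Leibler divergence of the Poisson law of mean [l0] relative to that of mean
    [l1]. *)
Let kl i w : R := (l1 i w - l0 i w) - h i w * l0 i w.

Let kl_ge0 i w : 0 <= kl i w.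
Proof.
rewrite subr_ge0 -ler_pdivlMr ?l0_gt0//; exact: (ln_sub_le (l1_gt0 i w) (l0_gt0 i w)).
Qed.

Let integrable_kl i : P.-integrable setT (EFin \o kl i).
Proof. exact: (integrableB measurableT (integrable_dist i) (integrable_l0h i)). Qed.

(** The contrast is a sum of terms [h * y - (l1 - l0)], and conditioning on the past replaces [y] by
    [l0]. *)
Lemma integral_contrastE :
  (\int[P]_w (contrast w)%:E = - \sum_(i < m) \int[P]_w (kl i w)%:E)%E.
Proof.
pose b i w := h i w * y i w - (l1 i w - l0 i w).
have ib i : P.-integrable setT (fun w => (b i w)%:E).
  exact: (integrableB measurableT (integrable_yh i) (integrable_dist i)).
transitivity (\int[P]_w (\sum_(i < m) (b i w)%:E))%E.
  apply: eq_integral => w _; rewrite sumEFin; congr EFin.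
  rewrite /contrast /poisson_loglik -sumrB; apply: eq_bigr => i _.
  by rewrite /b /h /l1 /l0 /y; ring.
rewrite integral_sum// -fin_num_sumeN; last first.
  by move=> i _; exact: (integrable_fin_num measurableT (integrable_kl i)).
apply: eq_bigr => i _.
rewrite (integralB measurableT (integrable_yh i) (integrable_dist i)).
rewrite -(integral_mul_cond_exp sigma_past past_sub (condY i))//; last first.
  by move=> w; exact: ltW.
rewrite (integralB measurableT (integrable_dist i) (integrable_l0h i)).
by rewrite fin_num_oppeB ?(integrable_fin_num measurableT (integrable_l0h i))// addeC.
Qed.

(** If the mean were zero, each non-negative divergence would vanish almost surely, and [ln_sub_lt]
    would force equal means in every coordinate. *)
Lemma contrast_lt0 : ~ {ae P, forall w, f0 (past w) = f1 (past w)} ->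
  (\int[P]_w (contrast w)%:E < 0)%E.
Proof.
move=> nae; rewrite integral_contrastE oppe_lt0.
have kl0 i : (0 <= \int[P]_w (kl i w)%:E)%E.
  by apply: integral_ge0 => w _; rewrite lee_fin.
rewrite lt0e sume_ge0// andbT; apply: contra_notN nae => /eqP sum0.
have kl_ae i : {ae P, forall w, l0 i w = l1 i w}.
  have : (\int[P]_w `|(kl i w)%:E| = 0)%E.
    under eq_integral do rewrite gee0_abs ?lee_fin//.
    apply/eqP; move/eqP: sum0; rewrite seq_psume_eq0// => /allP/(_ i).
    by rewrite mem_index_enum; exact.
  have /integrableP[mkl _] := integrable_kl i.
  move/(ae_eq_integral_abs P measurableT mkl); apply: filterS => w /(_ I) [klw].
  apply/eqP; rewrite eq_sym; apply: contra_eqT klw => l10; rewrite gt_eqF//.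
  rewrite subr_gt0 -ltr_pdivlMr ?l0_gt0//; exact: (ln_sub_lt (l1_gt0 i w) (l0_gt0 i w)).
have : {ae P, forall w, forall i, l0 i w = l1 i w}.
  exact: filter_forall.
by apply: filterS => w hw; apply/rowP => i; exact: hw.
Qed.

End contrast.

(** * Drift of the penalized contrast *)

Section drift.
Context {dO : measure_display} {Omega : measurableType dO} {R : realType}.
Variable P : probability Omega R.
Context {m : nat}.
Local Notation E := (m.-tuple nat).
Local Notation path := (count_path m).
Local Notation vec := (vec_of_count (R := R)).

Variable Y : int -> Omega -> E.
Hypothesis mY : forall t, measurable_fun setT (Y t).
Hypothesis statY : strictly_stationary P Y.
Hypothesis ergY : ergodic P Y.
Variable M : R.
Hypothesis momentY : forall t,
  (\int[P]_w (norm1 (vec (Y t w)) ^+ 2)%:E <= M%:E)%E.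
Variable a : nat -> R.
Hypothesis a0 : forall k, 0 <= a k.
Hypothesis suma : (\sum_(0 <= k <oo) (a k)%:E < +oo)%E.
Variable c : R.
Hypothesis c0 : 0 < c.

(** Anchored at time 1, so that the shifts by [k < n] produce the times [1] to [n] of the
    likelihood. *)
Definition path_contrast (f1 f0 : (nat -> E) -> 'rV[R]_m) (y : int -> E) : R :=
  poisson_loglik (y 1) (f1 (past_seq y 1)) -
  poisson_loglik (y 1) (f0 (past_seq y 1)).

(** [fine] gives 0 when the series diverges, which happens only on a null set of trajectories. *)
Definition trunc_error (K : nat) (y : int -> E) : R :=
  fine (lip a (past_seq y 1) (trunc K (past_seq y 1))).

(** Twice the weight times [2 * trunc_error + 1 / (K + 1)]: one such error for theta against
    [theta0], one for [theta_star] against itself. *)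
Definition trunc_penalty (K : nat) (y : int -> E) : R :=
  lip_weight c (y 1) * (4 * trunc_error K y + 2 * K.+1%:R^-1).

Lemma trunc_error_ge0 K y : 0 <= trunc_error K y.
Proof. by rewrite fine_ge0// lip_ge0. Qed.

Lemma measurable_trunc_penalty K :
  measurable_fun setT (trunc_penalty K : path -> R).
Proof.
have mU : measurable_fun setT (trunc_error K : path -> R).
  apply: (measurableT_comp (fine_measurable measurableT)).
  have := @measurable_path_lip R m a
    (fun k x => if (k < K)%N then cap_count K x else count0) 1 a0.
  exact.
apply: measurable_funM.
  exact: (measurable_path_coord (lip_weight c) 1).
by apply: measurable_funD => //; apply: measurable_funM.
Qed.

Lemma trunc_penalty_le K w :
  (`|trunc_penalty K (trajectory Y w)|%:E <= 4%:E * weight_lip Y a c 1 w)%E.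
Proof.
have U0 := trunc_error_ge0 K (trajectory Y w).
have V0 := lip_ge0 a0 (past_seq (trajectory Y w) 1) (fun=> count0).
have W0 := lip_weight_ge0 c0 (Y 1 w).
have K1 : K.+1%:R^-1 <= 1 :> R by rewrite invf_le1 ?ltr0n// ler1n.
have UV : ((trunc_error K (trajectory Y w))%:E <=
    lip a (past_seq (trajectory Y w) 1) (fun=> count0))%E.
  apply: le_trans (lip_trunc_le a0 K _); rewrite /trunc_error.
  by have := lip_ge0 a0 (past_seq (trajectory Y w) 1)
      (trunc K (past_seq (trajectory Y w) 1));
    case: (lip _ _ _) => //=; rewrite leey.
rewrite /trunc_penalty /weight_lip ger0_norm; last first.
  by rewrite mulr_ge0// addr_ge0 ?mulr_ge0// invr_ge0.
rewrite muleCA EFinM lee_wpmul2l ?lee_fin//.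
rewrite ge0_muleDr// mule1 EFinD leeD ?lee_fin//.
  by rewrite EFinM lee_wpmul2l ?lee_fin.
by move: K1; set v := _^-1 => v1; lra.
Qed.

Lemma integrable_trunc_penalty K :
  P.-integrable setT (fun w => (trunc_penalty K (trajectory Y w))%:E).
Proof.
apply: (integrable_le_weight_lip mY momentY a0 suma c0 (t := 1) (B := 4)
  (g := fun w => trunc_penalty K (trajectory Y w))) => [|w].
  exact: (measurable_comp_trajectory mY (measurable_trunc_penalty K)).
exact: trunc_penalty_le.
Qed.

Lemma integral_trunc_penalty_cvg0 :
  (\int[P]_w (trunc_penalty K (trajectory Y w))%:E)%E @[K --> \oo] --> 0%E.
Proof.
have iB := integrableZl measurableT 4 (integrable_weight_lip mY momentY a0 suma c0 1).
have [||||_ _] := @dominated_convergence _ Omega R P setT measurableT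
  (fun K w => (trunc_penalty K (trajectory Y w))%:E) (cst 0%E) _ _ _ _ iB.
- move=> K; apply/measurable_EFinP.
  exact: (measurable_comp_trajectory mY (measurable_trunc_penalty K)).
- exact: measurable_cst.
- apply: filterS (ae_lip_fin mY momentY a0 suma c0 1) => w Vfin _.
  have /fine_cvgP[_ U0] := lip_trunc_cvg a0 Vfin.
  apply/cvg_EFin; first exact: nearW.
  rewrite -(mulr0 (lip_weight c (Y 1 w))); apply: cvgM; first exact: cvg_cst.
  rewrite -(addr0 0) -{1}(mulr0 4); apply: cvgD.
    by apply: cvgM; [exact: cvg_cst|exact: U0].
  rewrite -{1}(mulr0 2); apply: cvgM; [exact: cvg_cst|exact: cvg_harmonic].
- by apply: aeW => w K _; exact: trunc_penalty_le.
by rewrite integral0.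
Qed.

Variables f1 f0 : (nat -> E) -> 'rV[R]_m.
Hypothesis lip_f1 : lipschitz_in_past a f1.
Hypothesis lip_f0 : lipschitz_in_past a f0.
Hypothesis c_f1 : forall y i, c <= f1 y 0 i.
Hypothesis c_f0 : forall y i, c <= f0 y 0 i.
Hypothesis m_f1 : forall i, measurable_wrt (product_sigma E nat) (fun y => f1 y 0 i).
Hypothesis m_f0 : forall i, measurable_wrt (product_sigma E nat) (fun y => f0 y 0 i).
Hypothesis condY : forall i, is_cond_exp P (past_sigma Y 1)
  (fun w => (tnth (Y 1 w) i)%:R) (fun w => f0 (past_seq (trajectory Y w) 1) 0 i).
Hypothesis f1_neq_f0 : ~ {ae P, forall w,
  f0 (past_seq (trajectory Y w) 1) = f1 (past_seq (trajectory Y w) 1)}.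

Definition shifted (w : Omega) (k : nat) : int -> E := fun t => Y (t + k%:Z) w.

Lemma penalized_contrast_drift : exists K, {ae P, forall w,
  \sum_(k < n) (path_contrast f1 f0 (shifted w k) + trunc_penalty K (shifted w k))
    @[n --> \oo] --> -oo}.
Proof.
have iD := integrable_contrast mY momentY a0 suma c0 lip_f1 lip_f0
  c_f1 c_f0 m_f1 m_f0 1.
have D0 := contrast_lt0 mY momentY a0 suma c0 lip_f1 lip_f0 c_f1 c_f0 m_f1 m_f0
  condY f1_neq_f0.
have /fineK DE := integrable_fin_num measurableT iD.
set r := fine _ in DE; have r0 : r < 0 by rewrite -lte_fin DE.
(* [K] is taken so large that the mean penalty stays below [- r], where [r < 0] is the mean
   contrast. *)
have /fine_cvgP[_ /cvgr0Pnorm_lt/(_ (- r))] := integral_trunc_penalty_cvg0.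
rewrite oppr_gt0 => /(_ r0)/filter_ex[K /= penK].
exists K; apply: (process_drift mY
  (g := fun y => path_contrast f1 f0 y + trunc_penalty K y)) => //.
- apply: (@measurable_wrtT _ _ path R _).2.
  apply: measurable_funD; last exact: measurable_trunc_penalty.
  by apply: measurable_funB; exact: measurable_path_loglik.
- exact: (integrableD measurableT iD (integrable_trunc_penalty K)).
have iK := integrable_trunc_penalty K.
have -> : (\int[P]_w (path_contrast f1 f0 (trajectory Y w) +
    trunc_penalty K (trajectory Y w))%:E = r%:E +
    \int[P]_w (trunc_penalty K (trajectory Y w))%:E)%E.
  by rewrite DE; exact: (integralD measurableT iD iK).
rewrite -(fineK (integrable_fin_num measurableT iK)) -EFinD lte_fin.
by rewrite -ltrBrDl sub0r (le_lt_trans (ler_norm _)).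
Qed.

End drift.

(** * Pathwise comparison of likelihoods *)

Section pathwise.
Context {R : realType} {m : nat} {S : Type}.
Local Notation E := (m.-tuple nat).
Local Notation vec := (vec_of_count (R := R)).

Variable f : S -> (nat -> E) -> 'rV[R]_m.
Variable Theta : set S.
Variable a : nat -> R.
Hypothesis a0 : forall k, 0 <= a k.
Variable c : R.
Hypothesis c0 : 0 < c.
Hypothesis lip_f : forall theta, Theta theta -> lipschitz_in_past a (f theta).
Hypothesis c_f : forall theta, Theta theta -> forall y i, c <= f theta y 0 i.

(** Closeness is required at truncated sequences only; these being finitely many, continuity makes
    this a neighbourhood within [Theta]. *)
Definition trunc_nbhd (K : nat) (theta0 : S) : set S :=
  [set theta | forall z,
     norm1 (f theta (trunc K z) - f theta0 (trunc K z)) <= K.+1%:R^-1].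

Variable y : int -> E.
Hypothesis y_fin : forall k : nat, (lip a (past_seq y k.+1%:Z) (fun=> count0) < +oo)%E.

Lemma past_seq_shift k :
  past_seq (fun t => y (t + k%:Z)) 1 = past_seq y k.+1%:Z.
Proof. by apply/funext => j; rewrite /past_seq; congr y; lia. Qed.

(** Where the past from time 1 on has been replaced by zeros, the index is at least [K], so the
    truncation is zero there too. *)
Lemma lip_truncated_past K t : (K < t)%N ->
  (lip a (truncated_past y t) (trunc K (past_seq y t)) <=
   lip a (past_seq y t) (trunc K (past_seq y t)))%E.
Proof.
move=> Kt; apply: le_lip => // k; rewrite /truncated_past; case: ifPn => // kt.
rewrite /trunc ifF ?subrr ?norm10 ?norm1_ge0//.
by apply/negbTE; rewrite -leqNgt; move: kt; rewrite -leqNgt; lia.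
Qed.

(** Three moves: from the observed past to the truncation at [theta], from [theta] to [theta0] at
    the truncation, and back to the infinite past at [theta0]. The outer two cost [trunc_error]
    each. *)
Lemma lambda_hat_close K k theta0 theta : Theta theta0 -> Theta theta ->
  trunc_nbhd K theta0 theta -> (K <= k)%N ->
  norm1 (lambda_hat f y k.+1 theta - f theta0 (past_seq y k.+1%:Z)) <=
  2 * trunc_error a K (fun t => y (t + k%:Z)) + K.+1%:R^-1.
Proof.
move=> T0 T1 Wtheta Kk; rewrite /trunc_error past_seq_shift.
set p := past_seq y _; set u := fine _.
have uE : lip a p (trunc K p) = u%:E.
  rewrite fineK// ge0_fin_numE ?lip_ge0//.
  exact: le_lt_trans (lip_trunc_le a0 K p) (y_fin k).
have close th z : Theta th -> (lip a z (trunc K p) <= lip a p (trunc K p))%E ->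
    norm1 (f th z - f th (trunc K p)) <= u.
  by move=> Tth zp; rewrite -lee_fin -uE (le_trans (lip_f Tth _ _)).
have h1 := close theta (truncated_past y k.+1) T1
  (lip_truncated_past (Kk : (K < k.+1)%N)).
have h2 := close theta0 p T0 (lexx _).
have h3 := Wtheta p.
rewrite /lambda_hat (le_trans (ler_norm1_dist _ (f theta (trunc K p)) _))//.
have h4 := ler_norm1_dist (f theta (trunc K p)) (f theta0 (trunc K p)) (f theta0 p).
rewrite norm1_distC in h2.
have add4 (A B C D u' v' : R) :
    A <= u' -> B <= u' -> C <= v' -> D <= C + B -> A + D <= 2 * u' + v' by lra.
exact: add4 h1 h2 h3 h4.
Qed.

Lemma ell_hat_diff_le K k theta0 theta_star theta :
  Theta theta0 -> Theta theta_star -> Theta theta ->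
  trunc_nbhd K theta0 theta -> (K <= k)%N ->
  ell_hat f y k.+1 theta - ell_hat f y k.+1 theta_star <=
  path_contrast (f theta0) (f theta_star) (fun t => y (t + k%:Z)) +
  trunc_penalty a c K (fun t => y (t + k%:Z)).
Proof.
move=> T0 Ts T1 Wtheta Kk.
have Wstar : trunc_nbhd K theta_star theta_star.
  by move=> z; rewrite subrr norm10 invr_ge0.
have h1 := lambda_hat_close T0 T1 Wtheta Kk.
have hs := lambda_hat_close Ts Ts Wstar Kk.
rewrite /path_contrast /trunc_penalty past_seq_shift.
have -> : y (1 + k%:Z) = y k.+1%:Z by congr y; lia.
set u := trunc_error _ _ _ in h1 hs *; set v := _^-1 in h1 hs *.
have W0 := lip_weight_ge0 c0 (y k.+1%:Z).
have diff_le th th' : Theta th -> Theta th' ->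
    norm1 (lambda_hat f y k.+1 th - f th' (past_seq y k.+1%:Z)) <= 2 * u + v ->
    `|ell_hat f y k.+1 th - poisson_loglik (y k.+1%:Z) (f th' (past_seq y k.+1%:Z))|
      <= lip_weight c (y k.+1%:Z) * (2 * u + v).
  move=> Tth Tth' h; apply: (le_trans (loglik_lipschitz c0 _ _ _)) => [i|i|].
  - exact: c_f.
  - exact: c_f.
  - exact: ler_wpM2l.
move: (diff_le _ _ T1 T0 h1) (diff_le _ _ Ts Ts hs).
rewrite !ler_norml => /andP[_ e1] /andP[es _].
have -> : 4 * u + 2 * v = (2 * u + v) + (2 * u + v) by ring.
rewrite mulrDr; move: e1 es; set w := _ * (_ + _).
set l1 := poisson_loglik _ _; set ls := poisson_loglik _ _.
have add5 (e e' l l' w' : R) :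
    e - l <= w' -> - w' <= e' - l' -> e - e' <= l - l' + (w' + w') by lra.
exact: add5.
Qed.

(** From time [K + 1] on, the likelihood increments are dominated by the penalized contrast. The
    first [K] terms exceed it by at most a constant that depends on the path but not on theta, and
    the drift to [-oo] absorbs that constant. *)
Lemma L_hat_lt_of_drift K theta0 theta_star :
  Theta theta0 -> Theta theta_star ->
  \sum_(k < n) (path_contrast (f theta0) (f theta_star) (fun t => y (t + k%:Z)) +
     trunc_penalty a c K (fun t => y (t + k%:Z))) @[n --> \oo] --> -oo ->
  exists N, forall n, (N <= n)%N -> forall theta, Theta theta ->
    trunc_nbhd K theta0 theta -> L_hat f y n theta < L_hat f y n theta_star.
Proof.
move=> T0 Ts.
pose g k := path_contrast (f theta0) (f theta_star) (fun t => y (t + k%:Z)) +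
  trunc_penalty a c K (fun t => y (t + k%:Z)).
rewrite -/(fun n => \sum_(k < n) g k) => drift.
(* [g k + b k] bounds the increment of index [k] for all theta at once, by [loglik_le_count]. *)
pose b k := \sum_(i < m) (tnth (y k.+1%:Z) i)%:R * ln ((tnth (y k.+1%:Z) i).+1)%:R
  - ell_hat f y k.+1 theta_star - g k.
have [N _ hN] : \forall n \near \oo, \sum_(k < n) g k < - \sum_(k < K) b k.
  exact: cvgrNy_lt.
exists (maxn N K) => n; rewrite geq_max => /andP[Nn Kn] theta T1 Wtheta.
have L_hatE th : L_hat f y n th = \sum_(k < n) ell_hat f y k.+1 th.
  by rewrite /L_hat big_add1 big_mkord.
rewrite -subr_lt0 !L_hatE -sumrB.
apply: (@le_lt_trans _ _ (\sum_(k < n) g k + \sum_(k < K) b k)); last first.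
  by rewrite -ltrBrDr sub0r; exact: hN.
rewrite (big_ord_widen n b Kn) [X in _ + X]big_mkcond -big_split.
apply: ler_sum => k _ /=.
have [kK|Kk] := ltnP k K.
  rewrite /b addrC subrK lerD2r.
  by apply: (loglik_le_count c0) => i; exact: c_f.
by rewrite addr0; exact: ell_hat_diff_le.
Qed.

End pathwise.

(** * Consistency *)

(** The finite subcover argument for a property stable under finite unions. [Good] will be an almost
    sure statement whose null set may depend on the neighbourhood. *)
Lemma compact_subset_of_local {T : topologicalType} (A : set T)
    (Good : set T -> Prop) :
  compact A -> Good set0 ->
  (forall U V, Good U -> Good V -> Good (U `|` V)) ->
  (forall x, A x -> exists2 U, Good U & \forall x' \near x, A x' -> U x') ->
  exists2 U, Good U & A `<=` U.
Proof.
move=> /compact_near_coveringP cA G0 GU local.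
(* The good sets are directed by inclusion; [F] is the filter of their tails. *)
pose F : set_system (set T) :=
  [set X | exists2 U, Good U & forall V, U `<=` V -> X V].
have FF : Filter F.
  split.
  - by exists set0.
  - move=> X X' [U GoodU UX] [U' GoodU' UX']; exists (U `|` U'); first exact: GU.
    by move=> V; rewrite subUset => -[UV U'V]; split; [exact: UX|exact: UX'].
  - by move=> X X' XX' [U GoodU UX]; exists U => // V UV; exact/XX'/UX.
have [U GoodU UX] : \forall V \near F, A `<=` (fun x => A x -> V x).
  apply: cA => x Ax; have [U GoodU nearU] := local x Ax.
  exists ([set x' | A x' -> U x'], [set V | U `<=` V]); first by split => //; exists U.
  by move=> [x' V] /= [x'U UV] Ax'; exact/UV/x'U.
by exists U => // x Ax; exact: (UX U).
Qed.

Lemma near_trunc_nbhd {R : realType} {m : nat} {S : topologicalType}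
    (f : S -> (nat -> m.-tuple nat) -> 'rV[R]_m) (Theta : set S) (theta0 : S) K :
  Theta theta0 -> (forall y, {within Theta, continuous (fun theta => f theta y)}) ->
  \forall theta \near theta0, Theta theta -> trunc_nbhd f K theta0 theta.
Proof.
move=> T0 contf; have [I [z truncz]] := trunc_finite (m := m) K.
suff : \forall theta \near within Theta (nbhs theta0),
    forall i, norm1 (f theta (z i) - f theta0 (z i)) <= K.+1%:R^-1.
  rewrite near_withinE; apply: filterS => theta h Tth y.
  by have [i ->] := truncz y; exact: h.
apply: filter_forall => i.
have /cvg_ball : f^~ (z i) @ within Theta (nbhs theta0) --> f theta0 (z i).
  by have /subspace_continuousP := contf (z i); exact.
(* Balls control each coordinate, and the [m] coordinates are summed; [m.+1] keeps the radius
   positive when [m = 0]. *)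
move=> /(_ (K.+1%:R^-1 / m.+1%:R)); rewrite divr_gt0 ?invr_gt0 ?ltr0n// => /(_ isT).
apply: filterS => theta [_ close].
apply: (@le_trans _ _ (\sum_(j < m) (K.+1%:R^-1 / m.+1%:R))).
  apply: ler_sum => j _; rewrite !mxE distrC; apply: ltW; exact: (close 0 j).
rewrite sumr_const card_ord -[_ *+ m]mulr_natr -mulrA ler_piMr ?invr_ge0//.
by rewrite mulrC ler_pdivrMr ?ltr0n// mul1r ler_nat.
Qed.

Lemma nneseries_from1 {R : realType} (F : nat -> \bar R) :
  (forall k, (1 <= k)%N -> 0 <= F k)%E ->
  (\sum_(1 <= k <oo) F k = \sum_(0 <= k <oo) F k.+1)%E.
Proof.
(* The sign of [F 0] is unknown, so it is replaced by 0 before the index is shifted. *)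
move=> F0; pose G k := if k is 0%N then 0%E else F k.
transitivity (\sum_(1 <= k <oo) G k)%E.
  by congr (limn _); apply/funext => n; apply: eq_big_nat => -[].
rewrite -nneseries_addn; last by case=> // k; exact: F0.
by apply: eq_eseriesr => k _; rewrite addn1.
Qed.

Lemma sup_norm_le_lip {R : realType} {m : nat} {S : Type} (Theta : set S)
    (f : S -> (nat -> m.-tuple nat) -> 'rV[R]_m) (alpha : nat -> R) :
  (forall k, (1 <= k)%N -> 0 <= alpha k) ->
  (forall y y' : nat -> m.-tuple nat,
     (sup_norm Theta (fun theta => f theta y - f theta y')%R
      <= \sum_(1 <= k <oo)
           (alpha k * norm1 (vec_of_count (y k.-1)
                             - vec_of_count (y' k.-1)))%:E)%E) ->
  forall theta, Theta theta -> lipschitz_in_past (alpha \o succn) (f theta).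
Proof.
move=> alpha0 lip_f theta Ttheta y z; apply: (@le_trans _ _ (sup_norm Theta
  (fun theta => f theta y - f theta z)%R)).
  by apply: ereal_sup_ubound; exists theta.
rewrite (le_trans (lip_f y z))// nneseries_from1// => k k1.
by rewrite lee_fin mulr_ge0 ?alpha0 ?norm1_ge0.
Qed.

Theorem theorem4p2 (R : realType) (dO : measure_display)
    (Omega : measurableType dO) (P : probability Omega R) (d m : nat)
    (Theta : set 'rV[R]_d) (theta_star : 'rV[R]_d)
    (f : 'rV[R]_d -> (nat -> m.-tuple nat) -> 'rV[R]_m)
    (Y : int -> Omega -> m.-tuple nat)
    (alpha : nat -> R) (gamma c C eps : R)
    (theta_hat : nat -> Omega -> 'rV[R]_d) :
  compact Theta ->
  Theta theta_star ->
  (forall theta, Theta theta -> forall i : 'I_m,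
     measurable_wrt (product_sigma (m.-tuple nat) nat)
       (fun y => f theta y 0 i)) ->
  (forall theta, Theta theta -> forall y (i : 'I_m), 0 <= f theta y 0 i) ->
  (forall t : int, measurable_fun setT (Y t)) ->
  strictly_stationary P Y ->
  ergodic P Y ->
  (forall (t : int) (i : 'I_m),
     is_cond_exp P (past_sigma Y t)
       (fun w => (tnth (Y t w) i)%:R)
       (fun w => f theta_star (past_seq (trajectory Y w) t) 0 i)) ->
  (forall y, {within Theta, continuous (fun theta => f theta y)}) ->
  (sup_norm Theta (fun theta => f theta (fun=> count0)) < +oo)%E ->
  (forall k, (1 <= k)%N -> 0 <= alpha k) ->
  (\sum_(1 <= k <oo) (alpha k)%:E < 1)%E ->
  (forall y y' : nat -> m.-tuple nat,
     (sup_norm Theta (fun theta => f theta y - f theta y')%R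
      <= \sum_(1 <= k <oo)
           (alpha k * norm1 (vec_of_count (y k.-1)
                             - vec_of_count (y' k.-1)))%:E)%E) ->
  3 / 2 < gamma ->
  alpha =O_\oo (fun k : nat => k%:R `^ (- gamma)) ->
  (forall theta, Theta theta ->
     (exists t : int, {ae P, forall w,
        f theta_star (past_seq (trajectory Y w) t)
        = f theta (past_seq (trajectory Y w) t)}) ->
     theta_star = theta) ->
  0 < c ->
  (forall theta, Theta theta -> forall y (i : 'I_m), c <= f theta y 0 i) ->
  0 < C ->
  1 <= eps ->
  (forall t : int,
     ('N[P]_((1 + eps)%:E)
        [(fun w => (norm1 (vec_of_count (R := R) (Y t w)))%:E)]
      < C%:E)%E) ->
  (forall (n : nat) (w : Omega), (0 < n)%N ->
     is_qmle f Theta (trajectory Y w) n (theta_hat n w)) ->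
  {ae P, forall w, (fun n => theta_hat n w) @ \oo --> theta_star}.
Proof.
move=> cTheta Tstar m_f f_ge0 mY statY ergY condY contf _ alpha0 alpha1 supf _ _.
move=> ident c0 c_f _ eps1 momentY qmle.
have lip_f := sup_norm_le_lip alpha0 supf.
set a := alpha \o succn in lip_f.
have a0 k : 0 <= a k by exact: alpha0.
have suma : (\sum_(0 <= k <oo) (a k)%:E < +oo)%E.
  apply: le_lt_trans (ltry 1); rewrite ltW//; move: alpha1.
  by rewrite nneseries_from1// => k k1; rewrite lee_fin alpha0.
have moment t := square_moment_of_Lnorm
  (measurableT_comp (measurable_count (fun x => norm1 (vec_of_count (R := R) x))) (mY t))
  eps1 (momentY t).
have fin_w : {ae P, forall w, forall k : nat,
    (lip a (past_seq (trajectory Y w) k.+1%:Z) (fun=> count0) < +oo)%E}.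
  by apply: ae_foralln => k; exact: (ae_lip_fin mY moment a0 suma c0).
(* The alternative [ball theta_star rho] makes a neighbourhood of [theta_star] itself good, so that
   all of [Theta] can be covered. *)
pose Good rho (U : set 'rV[R]_d) := {ae P, forall w, exists N, forall n, (N <= n)%N ->
  forall theta, Theta theta -> U theta -> ball theta_star rho theta \/
    L_hat f (trajectory Y w) n theta < L_hat f (trajectory Y w) n theta_star}.
have cover rho : 0 < rho -> exists2 U, Good rho U & Theta `<=` U.
  move=> rho0; apply: compact_subset_of_local => //.
  - by apply: aeW => w; exists 0%N.
  - move=> U V; rewrite /Good; apply: filterS2 => w [N hN] [N' hN'].
    exists (maxn N N') => n; rewrite geq_max => /andP[Nn N'n] theta Tt [Ut|Vt].
      exact: hN.
    exact: hN'.
  move=> theta0 T0; have [eq_star|neq_star] := pselect (theta_star = theta0).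
    exists (ball theta_star rho).
      by apply: aeW => w; exists 0%N => n _ theta _ ?; left.
    rewrite -eq_star; have := nbhsx_ballx theta_star rho rho0.
    by apply: filterS => theta.
  have neq_ae : ~ {ae P, forall w, f theta_star (past_seq (trajectory Y w) 1) =
      f theta0 (past_seq (trajectory Y w) 1)}.
    by move=> ae_eq; apply: neq_star; apply: ident => //; exists 1.
  have [K driftK] := penalized_contrast_drift mY statY ergY moment a0 suma c0
    (lip_f _ T0) (lip_f _ Tstar) (c_f _ T0) (c_f _ Tstar) (m_f _ T0) (m_f _ Tstar)
    (condY 1) neq_ae.
  exists (trunc_nbhd f K theta0); last exact: near_trunc_nbhd.
  rewrite /Good; apply: filterS2 fin_w driftK => w finw driftw.
  have [N hN] := L_hat_lt_of_drift a0 c0 lip_f c_f finw T0 Tstar driftw.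
  by exists N => n Nn theta Tt Wt; right; exact: hN.
(* Countably many radii suffice, so the exceptional sets can be united into one null set. *)
have close j : {ae P, forall w, \forall n \near \oo,
    ball theta_star (j.+1%:R^-1 : R) (theta_hat n w)}.
  have [|U GU TU] := cover j.+1%:R^-1; first by rewrite invr_gt0.
  (* The estimator is a maximizer only for [n >= 1]. Outside the ball it would have a smaller
     likelihood than [theta_star]. *)
  move: GU; rewrite /Good; apply: filterS => w [N hN]; exists (maxn N 1) => // n /=.
  rewrite geq_max => /andP[Nn n0]; have [Tn maxn] := qmle n w n0.
  have [//|] := hN n Nn _ Tn (TU _ Tn).
  by rewrite ltNge maxn.
apply: filterS (ae_foralln close) => w closew; apply/cvg_ballP => e e0.
have [j je] : exists j : nat, j.+1%:R^-1 < e.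
  have /cvgr0Pnorm_lt/(_ e e0)/filter_ex[j /=] := @cvg_harmonic R.
  by rewrite ger0_norm ?invr_ge0// => je; exists j.
by apply: filterS (closew j) => n; apply: le_ball; exact: ltW.
Qed.
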